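(* Consider a cell $m$ of the multi-cell over-the-air federated learning system described in the context, with $K_m$ devices indexed by $k\in\mathcal{K}_m$, local loss functions $F_{m,k}:\mathbb{R}^D\to\mathbb{R}$ and global loss $F_m=\frac{1}{K_m}\sum_{k\in\mathcal{K}_m}F_{m,k}$. Assume: (i) $F_m$ is lower bounded: there is $\bm{w}_m^\star$ with $F_m(\bm{w})\ge F_m(\bm{w}_m^\star)>-\infty$ for all $\bm{w}\in\mathbb{R}^D$; (ii) every $F_{m,k}$ is continuously differentiable with $L$-Lipschitz gradient, $L>0$: $\|\nabla F_{m,k}(\bm{w})-\nabla F_{m,k}(\widetilde{\bm{w}})\|\le L\|\bm{w}-\widetilde{\bm{w}}\|$ for all $\bm{w},\widetilde{\bm{w}}\in\mathbb{R}^D$. If the learning rate is constant, $\eta_m^t\equiv\eta_m$ with $0<\eta_m<\frac{1}{L}$, then after $T$ rounds \[ \frac{1}{T}\sum_{t=0}^{T-1}\mathbb{E}\big[\|\nabla F_m(\bm{w}_m^t)\|^2\big]\le \frac{2}{\eta_m T}\big(F_m(\bm{w}_m^0)-F_m(\bm{w}_m^\star)\big)+\frac{1}{T}\sum_{t=0}^{T-1}\sum_{d=1}^{D}\Big(\frac{L^2}{K_m}\sum_{k\in\mathcal{K}_m}\mathbb{E}\big[\Re\{(e^{\rm dl}_{k,d})^{t+1}\}^2\big]+\frac{L\eta_m}{K_m^2}\mathbb{E}\big[\Re\{(e^{\rm ul}_{m,d})^{t+1}\}^2\big]\Big), \] where the expectation is taken over the normalized transmit symbols and the receiver noise.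
   Context: System: $M$ single-antenna base stations (BSs) $m\in\mathcal{M}=\{1,\dots,M\}$; BS $m$ serves a set $\mathcal{K}_m$ of $K_m$ single-antenna devices (sets disjoint across cells), all cells sharing one frequency channel. Each cell runs its own FL task with model $\bm{w}_m\in\mathbb{R}^D$. Round $t\in\{1,\dots,T\}$: (1) Downlink: BS $m$ normalizes $\bm{w}_m^{t-1}$ as $(\bm{s}^{\rm dl}_m)^t=(\bm{w}_m^{t-1}-\bar w_m^{t-1}\bm{1})/\nu_m^{t-1}$, where $\bar w_m^{t-1}$ and $\nu_m^{t-1}>0$ are the mean and standard deviation of the $D$ entries of $\bm{w}_m^{t-1}$, and transmits it with power $(p_m^{\rm dl})^t$. With complex channel coefficients $(h_k^{\rm dl})^t$ (home BS to device $k\in\mathcal{K}_m$) and $(h^{\rm dl}_{l,k})^t$ (BS $l\neq m$ to device $k$), and noise $(z^{\rm dl}_{k,d})^t\sim\mathcal{CN}(0,(\sigma_k^{\rm dl})^2)$, device $k$ obtains $\widehat{\bm{w}}_k^t=\bm{w}_m^{t-1}+\Re\{(\bm{e}_k^{\rm dl})^t\}$ with downlink error entries $(e^{\rm dl}_{k,d})^t=\frac{((h_k^{\rm dl})^t)^\dagger\nu_m^{t-1}}{|(h_k^{\rm dl})^t|^2\sqrt{(p_m^{\rm dl})^t}}\Big(\sum_{l\in\mathcal{M}\setminus\{m\}}(h^{\rm dl}_{l,k})^t\sqrt{(p_l^{\rm dl})^t}(s^{\rm dl}_{l,d})^t+(z^{\rm dl}_{k,d})^t\Big)$. (2) Device $k\in\mathcal{K}_m$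 computes $\bm{g}_k^t=\nabla F_{m,k}(\widehat{\bm{w}}_k^t)$. (3) Uplink (over-the-air computation): device $k$ normalizes $(\bm{s}_k^{\rm ul})^t=(\bm{g}_k^t-\bar g_k^t\bm{1})/\upsilon_k^t$ (mean $\bar g_k^t$ and standard deviation $\upsilon_k^t>0$ of the entries of $\bm{g}_k^t$), transmits with power $(p_k^{\rm ul})^t$ after phase compensation; with channel coefficients $(h_k^{\rm ul})^t$ (device $k$ to its home BS), $(h^{\rm ul}_{k,l})^t$ (device $k$ to BS $l$), noise $(z^{\rm ul}_{m,d})^t\sim\mathcal{CN}(0,(\sigma_m^{\rm ul})^2)$ and receive normalizing factor $c_m^t>0$, BS $m$ obtains $\widehat{\bm{g}}_m^t=\frac{1}{K_m}\big(\sum_{k\in\mathcal{K}_m}\bm{g}_k^t+\Re\{(\bm{e}^{\rm ul}_m)^t\}\big)$ with $(e^{\rm ul}_{m,d})^t=\sum_{k\in\mathcal{K}_m}\Big(\frac{|(h_k^{\rm ul})^t|\sqrt{(p_k^{\rm ul})^t}}{\sqrt{c_m^t}}-\upsilon_k^t\Big)(s^{\rm ul}_{k,d})^t+\frac{(z^{\rm ul}_{m,d})^t}{\sqrt{c_m^t}}+\sum_{l\in\mathcal{M}\setminus\{m\}}\sum_{k'\in\mathcal{K}_l}\frac{(h^{\rm ul}_{k',m})^t((h^{\rm ul}_{k'})^t)^\dagger\sqrt{(p^{\rm ul}_{k'})^t}(s^{\rm ul}_{k',d})^t}{|(h^{\rm ul}_{k'})^t|\sqrt{c_m^t}}$. (4)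 Global update: $\bm{w}_m^t=\bm{w}_m^{t-1}-\eta_m^t\widehat{\bm{g}}_m^t$; $\bm{w}_m^0$ is the initial model. Modeling conventions: the normalized symbol entries $s$ are treated as random with zero mean and unit variance, uncorrelated across different cells and across different devices; receiver noises are independent zero-mean complex Gaussian; expectations are over these symbols and noises (channels and powers fixed). $\Re\{\cdot\}$ denotes real part, $(\cdot)^\dagger$ complex conjugate, $\bm{1}$ the all-ones vector in $\mathbb{R}^D$.
   Formalization: Proved with the added assumption that the uplink symbols and uplink noise of each round are independent of all symbols and noises of earlier rounds and of that round's downlink; zero mean, unit variance and uncorrelatedness across cells and devices alone do not suffice for the bound. *)

(* Defs.v *)
From HB Require Import structures.
From mathcomp Require Import all_boot all_order all_algebra.
From mathcomp Require Import all_classical all_reals all_analysis.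
From mathcomp Require Import complex.

Set Implicit Arguments.
Unset Strict Implicit.
Unset Printing Implicit Defensive.

Import Order.TTheory GRing.Theory Num.Theory.
Import numFieldNormedType.Exports.
Local Open Scope classical_set_scope.
Local Open Scope ring_scope.
Local Open Scope complex_scope.

(* Euclidean geometry on R^D, represented as row vectors 'rV[R]_D.           *)
(* (The canonical norm of 'rV in MathComp-Analysis is the max-norm, so the   *)
(*  Euclidean norm is defined explicitly.)                                   *)
Section Vec.
Variables (R : realType) (D : nat).

Definition dotv (u v : 'rV[R]_D) : R := \sum_(i < D) u 0 i * v 0 i.
Definition enorm (u : 'rV[R]_D) : R := Num.sqrt (dotv u u).

Definition meanv (u : 'rV[R]_D) : R := (D%:R)^-1 * \sum_(i < D) u 0 i.
Definition stdv (u : 'rV[R]_D) : R :=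
  Num.sqrt ((D%:R)^-1 * \sum_(i < D) (u 0 i - meanv u) ^+ 2).
End Vec.

Definition cabs (R : realType) (z : R[i]) : R :=
  Num.sqrt (complex.Re z ^+ 2 + complex.Im z ^+ 2).

(* Fixed (deterministic) channel coefficients and powers seen by cell m.     *)
(*  K  = K_m devices of cell m (indexed by 'I_K),                            *)
(*  Mo = M - 1 other base stations l <> m (indexed by 'I_Mo),                *)
(*  Kx = total number of devices of the other cells, i.e. the pairs          *)
(*       (l, k') with l <> m, k' in K_l, flattened (indexed by 'I_Kx).       *)
(* All quantities are indexed by the round t.                                *)
Record channels (R : realType) (K Mo Kx : nat) := Channels {
  hdl  : nat -> 'I_K -> R[i];          (* (h_k^dl)^t : home BS -> device k *)
  hdlx : nat -> 'I_Mo -> 'I_K -> R[i]; (* (h_{l,k}^dl)^t : BS l -> device k *)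
  pdl  : nat -> R;
  pdlx : nat -> 'I_Mo -> R;
  hul  : nat -> 'I_K -> R[i];          (* (h_k^ul)^t : device k -> BS m *)
  pul  : nat -> 'I_K -> R;
  cul  : nat -> R;
  hulx : nat -> 'I_Kx -> R[i];         (* (h_{k',m}^ul)^t : device k' -> BS m *)
  hulh : nat -> 'I_Kx -> R[i];         (* (h_{k'}^ul)^t : device k' -> its home BS *)
  pulx : nat -> 'I_Kx -> R
}.

(* Random normalized symbols and receiver noises (random variables on Omega) *)
Record randomness (R : realType) (Omega : Type) (D K Mo Kx : nat) := Randomness {
  sdlx : nat -> 'I_Mo -> 'I_D -> Omega -> R;
  zdl  : nat -> 'I_K -> 'I_D -> Omega -> R[i];
  sul  : nat -> 'I_K -> 'I_D -> Omega -> R;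
  sulx : nat -> 'I_Kx -> 'I_D -> Omega -> R;
  zul  : nat -> 'I_D -> Omega -> R[i]
}.

Section System.
Variables (R : realType) (Omega : Type) (D K Mo Kx : nat).
Variables (ch : channels R K Mo Kx) (rv : randomness R Omega D K Mo Kx).

(* downlink error entry (e_{k,d}^dl)^t, where nu = nu_m^{t-1} *)
Definition edl_c (t : nat) (k : 'I_K) (nu : R) (d : 'I_D) (w : Omega) : R[i] :=
  (((hdl ch t k)^* * nu%:C) / ((cabs (hdl ch t k) ^+ 2)%:C * (Num.sqrt (pdl ch t))%:C)) *
  (\sum_(l < Mo) hdlx ch t l k * (Num.sqrt (pdlx ch t l) * sdlx rv t l d w)%:C
   + zdl rv t k d w).

Definition eul_c (t : nat) (ups : 'I_K -> R) (d : 'I_D) (w : Omega) : R[i] :=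
  \sum_(k < K) ((cabs (hul ch t k) * Num.sqrt (pul ch t k) / Num.sqrt (cul ch t) - ups k)
                 * sul rv t k d w)%:C
  + zul rv t d w / (Num.sqrt (cul ch t))%:C
  + \sum_(k' < Kx) (hulx ch t k' * (hulh ch t k')^* * (Num.sqrt (pulx ch t k') * sulx rv t k' d w)%:C)
                   / ((cabs (hulh ch t k') * Num.sqrt (cul ch t))%:C).

Variables (gF : 'I_K -> 'rV[R]_D -> 'rV[R]_D) (eta : R) (w0 : 'rV[R]_D).

(* Round t, given the previous global model wp = w_m^{t-1}:                  *)
(* received model  hat w_k^t = w_m^{t-1} + Re{e_k^dl}                         *)
Definition what (t : nat) (wp : 'rV[R]_D) (k : 'I_K) (w : Omega) : 'rV[R]_D :=
  wp + \row_(d < D) complex.Re (edl_c t k (stdv wp) d w).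
Definition glocal (t : nat) (wp : 'rV[R]_D) (k : 'I_K) (w : Omega) : 'rV[R]_D :=
  gF k (what t wp k w).
Definition ups (t : nat) (wp : 'rV[R]_D) (w : Omega) (k : 'I_K) : R :=
  stdv (glocal t wp k w).
Definition eulRe_of (t : nat) (wp : 'rV[R]_D) (w : Omega) : 'rV[R]_D :=
  \row_(d < D) complex.Re (eul_c t (ups t wp w) d w).
Definition ghat (t : nat) (wp : 'rV[R]_D) (w : Omega) : 'rV[R]_D :=
  (K%:R)^-1 *: (\sum_(k < K) glocal t wp k w + eulRe_of t wp w).

Fixpoint wproc (t : nat) (w : Omega) : 'rV[R]_D :=
  match t with
  | 0 => w0
  | t'.+1 => wproc t' w - eta *: ghat t'.+1 (wproc t' w) w
  end.

(* Re{(e_{k,d}^dl)^t} and Re{(e_{m,d}^ul)^t} of the actual process (t >= 1) *)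
Definition edlRe (t : nat) (k : 'I_K) (d : 'I_D) (w : Omega) : R :=
  complex.Re (edl_c t k (stdv (wproc t.-1 w)) d w).
Definition eulRe (t : nat) (d : 'I_D) (w : Omega) : R :=
  eulRe_of t (wproc t.-1 w) w 0 d.
End System.

Definition Fglob (R : realType) (D K : nat) (F : 'I_K -> 'rV[R]_D -> R) (w : 'rV[R]_D) : R :=
  (K%:R)^-1 * \sum_(k < K) F k w.

Section Indep.
Context {R : realType} {d : measure_display} {Omega : measurableType d}.

Definition sigma_gen (fam : set (Omega -> R)) : set (set Omega) :=
  <<s [set A | exists f B, fam f /\ measurable B /\ A = f @^-1` B] >>.

Definition indep_sigma (P : probability Omega R) (F G : set (set Omega)) : Prop :=
  forall A B, F A -> G B -> P (A `&` B) = (P A * P B)%E.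
End Indep.

Section Families.
Variables (R : realType) (Omega : Type) (D K Mo Kx : nat).
Variable rv : randomness R Omega D K Mo Kx.

Definition dl_family (t : nat) : set (Omega -> R) :=
  [set f | (exists l dd, f = sdlx rv t l dd) \/
           (exists k dd, f = (fun w => complex.Re (zdl rv t k dd w)) \/
                         f = (fun w => complex.Im (zdl rv t k dd w)))].

Definition ul_family (t : nat) : set (Omega -> R) :=
  [set f | (exists k dd, f = sul rv t k dd) \/ (exists k dd, f = sulx rv t k dd) \/
           (exists dd, f = (fun w => complex.Re (zul rv t dd w)) \/
                       f = (fun w => complex.Im (zul rv t dd w)))].

(* everything that happened before the uplink of round t *)
Definition hist_family (t : nat) : set (Omega -> R) :=
  [set f | exists s, ((1 <= s <= t)%N /\ dl_family s f) \/ ((1 <= s < t)%N /\ ul_family s f)].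

Definition all_family : set (Omega -> R) :=
  [set f | exists t, dl_family t f \/ ul_family t f].
End Families.

(* z is a circularly-symmetric complex Gaussian CN(0, sigma^2): real and     *)
(* imaginary parts independent, each N(0, sigma^2 / 2).                      *)
Definition cgauss {R : realType} {d : measure_display} {Omega : measurableType d}
    (P : probability Omega R) (z : Omega -> R[i]) (sigma : R) : Prop :=
  0 < sigma /\
  (forall A : set R, measurable A ->
     P ((fun w => complex.Re (z w)) @^-1` A) = normal_prob 0 (sigma / Num.sqrt 2) A) /\
  (forall A : set R, measurable A ->
     P ((fun w => complex.Im (z w)) @^-1` A) = normal_prob 0 (sigma / Num.sqrt 2) A) /\
  indep_sigma P (sigma_gen [set (fun w => complex.Re (z w))])
                (sigma_gen [set (fun w => complex.Im (z w))]).

(* Main.v *)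
Require Import Defs.
From HB Require Import structures.
From mathcomp Require Import all_boot all_order all_algebra.
From mathcomp Require Import all_classical all_reals all_analysis measurable_realfun.
From mathcomp Require Import complex.
From mathcomp Require Import ring lra.
Import Order.TTheory GRing.Theory Num.Theory.
Import numFieldNormedType.Exports.
Local Open Scope classical_set_scope.
Local Open Scope ring_scope.

(* Telescoping the descent inequality for the L-smooth function [Fglob F] along the
   trajectory bounds, for every outcome, the sum of the squared gradient norms by the
   claimed right-hand side plus a cross term, linear in the uplink errors, whose
   coefficients depend only on what happened before the uplink. Each uplink error is a
   linear combination, with coefficients known before the uplink, of centred symbols
   and noises independent of the past, so the cross term has mean zero as soon as
   everything is square integrable. If the right-hand side is finite, then so are the
   second moments of all the errors, and the Lipschitz gradients propagate square
   integrability along the recursion; otherwise there is nothing to prove. *)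

(** * Expectation of a product of independent random variables *)

Section independence.
Local Open Scope ereal_scope.
Context (R : realType) (d : measure_display) (T : measurableType d).
Variable P : probability T R.

(** Independence says that the joint law of [(X, Y)] and the product of the two laws agree on
    rectangles, hence everywhere. Tonelli then gives integrability of the product, and Fubini
    factors its integral. *)
Lemma independent_integrableM (X Y : {mfun T >-> R}) :
  (forall A B : set R, measurable A -> measurable B ->
     P (X @^-1` A `&` Y @^-1` B) = P (X @^-1` A) * P (Y @^-1` B)) ->
  P.-integrable setT (EFin \o X) -> P.-integrable setT (EFin \o Y) ->
  P.-integrable setT (EFin \o (X \* Y)%R) /\
  \int[P]_w (X w * Y w)%:E = \int[P]_w (X w)%:E * \int[P]_w (Y w)%:E.
Proof.
move=> indXY iX iY.
have mXY : measurable_fun setT (fun w => (X w, Y w)) by exact/measurable_fun_pair.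
pose XY : {mfun T >-> (R * R)%type} := HB.pack (fun w => (X w, Y w))
  (isMeasurableFun.Build _ _ _ _ _ mXY).
(* A measure with the right values on rectangles is the product measure. *)
have prodE A : measurable A ->
    (distribution P X \x distribution P Y) A = distribution P XY A.
  apply: product_measure_unique => B C mB mC.
  by rewrite /distribution /pushforward -indXY.
pose f (z : R * R) : \bar R := (z.1 * z.2)%:E.
have mf : measurable_fun setT f.
  by apply/measurable_EFinP; apply: measurable_funM.
have abs_lty (Z : {mfun T >-> R}) : P.-integrable setT (EFin \o Z) ->
    \int[distribution P Z]_x `|x%:E| < +oo.
  move=> /integrableP[_]; rewrite (ge0_integral_distribution Z)//.
  exact/measurableT_comp/measurable_EFinP.
have iid (Z : {mfun T >-> R}) : P.-integrable setT (EFin \o Z) ->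
    (distribution P Z).-integrable setT EFin.
  move=> iZ; apply/integrableP; split; first exact/measurable_EFinP.
  exact: abs_lty.
have finZ (Z : {mfun T >-> R}) : P.-integrable setT (EFin \o Z) ->
    \int[distribution P Z]_x `|x%:E| \is a fin_num.
  move=> iZ; rewrite ge0_fin_numE; first exact: abs_lty.
  exact: integral_ge0.
have iprod : (distribution P X \x distribution P Y).-integrable setT f.
  apply/integrable12ltyP => //.
  rewrite (eq_integral (fun x : R => `|x%:E| * \int[distribution P Y]_y `|y%:E|)).
    rewrite ge0_integralZr//.
    - by rewrite lte_mul_pinfty ?integral_ge0 ?finZ ?abs_lty.
    - exact/measurableT_comp/measurable_EFinP.
    - exact: integral_ge0.
  move=> x _; rewrite -ge0_integralZl//.
    by apply: eq_integral => y _; rewrite /f EFinM abseM.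
  exact/measurableT_comp/measurable_EFinP.
have ijoint : (distribution P XY).-integrable setT f.
  apply/integrableP; split => //.
  rewrite (eq_measure_integral (distribution P X \x distribution P Y)).
    by case/integrableP : iprod.
  by move=> A mA _; exact/esym/prodE.
have iXY : P.-integrable setT (EFin \o (X \* Y)%R).
  apply/integrableP; split; first exact/measurable_EFinP/measurable_funM.
  case/integrableP : ijoint => _; rewrite (ge0_integral_distribution XY)//.
  exact/measurableT_comp.
split => //.
transitivity (\int[distribution P XY]_z f z).
  by rewrite (integral_distribution (X := XY)).
rewrite (eq_measure_integral (distribution P X \x distribution P Y)); last first.
  by move=> A mA _; exact/esym/prodE.
rewrite -integral12_prod_meas1//.
rewrite -(integral_distribution (X := X) (@EFin_measurable R setT))//.
rewrite -(integral_distribution (X := Y) (@EFin_measurable R setT))//.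
rewrite /fubini_F.
(* The inner integral is finite, so it leaves the outer one as a real scalar. *)
set eY := \int[distribution P Y]_y y%:E.
have eYfin : eY \is a fin_num := integrable_fin_num measurableT (iid _ iY).
rewrite -(fineK eYfin) -integralZr//; last exact: iid.
apply: eq_integral => x _; rewrite fineK// -integralZl//; exact: iid.
Qed.

End independence.

(** * First moment of the centred Gaussian *)

Section gaussian.
Set Implicit Arguments.
Unset Strict Implicit.
Local Open Scope ereal_scope.
Context (R : realType).
Notation mu := (@lebesgue_measure R).

(** The Radon-Nikodym derivative and the Gaussian density have the same integral over every
    measurable set, so they agree almost everywhere. *)
Lemma ge0_integral_normal_prob (m s : R) (f : R -> \bar R) :
  measurable_fun setT f -> (forall x, 0 <= f x) ->
  \int[normal_prob m s]_x f x = \int[mu]_x (f x * (normal_pdf m s x)%:E).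
Proof.
move=> mf f0; have dom := normal_prob_dominates m s.
rewrite -(Radon_Nikodym_SigmaFinite.change_of_variables dom)//.
have mRN := measurable_int _ (Radon_Nikodym_SigmaFinite.f_integrable dom).
have mpdf : measurable_fun setT (fun x => (normal_pdf m s x)%:E).
  by apply/measurable_EFinP; exact: measurable_normal_pdf.
apply: ae_eq_integral => //.
- exact: emeasurable_funM.
- exact: emeasurable_funM.
- apply: ae_eqe_mul2l; apply: integral_ae_eq => //.
  + exact: Radon_Nikodym_SigmaFinite.f_integrable.
  + by move=> E _ mE; rewrite -Radon_Nikodym_SigmaFinite.f_integral.
Qed.

Lemma integrable_normal_prob_id (s : R) : s != 0%R ->
  (normal_prob 0 s).-integrable setT (EFin : R -> \bar R).
Proof.
move=> s0; apply/integrableP; split; first exact/measurable_EFinP.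
rewrite ge0_integral_normal_prob//; last exact/measurableT_comp/measurable_EFinP.
have r20 : (Num.sqrt 2 * s != 0 :> R)%R by rewrite mulf_neq0// gt_eqF// sqrtr_gt0.
set s' := (Num.sqrt 2 * s)%R in r20.
have s'2 : (s' ^+ 2 = 2 * s ^+ 2)%R by rewrite exprMn sqr_sqrtr.
have s2 : (0 < s ^+ 2)%R by rewrite exprn_even_gt0.
pose C := ((1 + 4 * s ^+ 2) * normal_peak s / normal_peak s')%R.
have pk0 := normal_peak_gt0 s0.
have pk'0 := normal_peak_gt0 r20.
have pk'n0 : normal_peak s' != 0%R by rewrite gt_eqF.
(* |x| <= 1 + x^2 and x^2 / (4 s^2) <= expR (x^2 / (4 s^2)), and the product of
   the latter with the density of variance s^2 has the shape of variance 2 s^2 *)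
have bnd (x : R) : (`|x| * normal_pdf 0 s x <= C * normal_pdf 0 s' x)%R.
  rewrite !normal_pdfE// /normal_fun !subr0 /C.
  rewrite [leRHS](_ : _ = (1 + 4 * s ^+ 2) *
      (normal_peak s * expR (- x ^+ 2 / (s' ^+ 2 *+ 2))))%R; last first.
    by field.
  rewrite mulrCA [leRHS]mulrCA ler_pM2l//.
  pose u := (x ^+ 2 / (4 * s ^+ 2))%R.
  have -> : (- x ^+ 2 / (s ^+ 2 *+ 2) = - u - u)%R.
    by rewrite /u; field.
  have -> : (- x ^+ 2 / (s' ^+ 2 *+ 2) = - u)%R.
    by rewrite s'2 /u; field.
  have u0 : (0 <= u)%R by rewrite /u divr_ge0 ?sqr_ge0// mulr_ge0// ltW.
  rewrite expRD mulrA ler_pM2r ?expR_gt0//.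
  have x2E : (x ^+ 2 = 4 * s ^+ 2 * u)%R by rewrite /u; field.
  have eu : (u * expR (- u) <= 1)%R.
    rewrite expRN ler_pdivrMr ?expR_gt0// mul1r.
    by apply: le_trans (expR_ge1Dx u); rewrite lerDr.
  have eu1 : (expR (- u) <= 1)%R by rewrite -expR0 ler_expR oppr_le0.
  have absx : (`|x| <= 1 + x ^+ 2)%R.
    by rewrite -real_normK ?num_real//; nra.
  apply: (@le_trans _ _ ((1 + x ^+ 2) * expR (- u))%R).
    by rewrite ler_wpM2r// expR_ge0.
  by rewrite x2E; have := expR_ge0 (- u)%R; nra.
apply: (@le_lt_trans _ _ (\int[mu]_x (C%:E * (normal_pdf 0 s' x)%:E))).
  apply: ge0_le_integral => //.
  - by move=> x _; rewrite mule_ge0// lee_fin normal_pdf_ge0.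
  - apply: emeasurable_funM; first exact/measurableT_comp/measurable_EFinP.
    by apply/measurable_EFinP; exact: measurable_normal_pdf.
  - apply: measurable_funeM; apply/measurable_EFinP.
    exact: measurable_normal_pdf.
  - by move=> x _; rewrite -EFinM lee_fin.
rewrite integralZl//; last exact: integrable_normal_pdf.
by rewrite integral_normal_pdf mule1 ltry.
Qed.

(** The centred density is even and Lebesgue measure is invariant under reflection. *)
Lemma normal_probN (s : R) (A : set R) : s != 0%R -> measurable A ->
  pushforward (normal_prob 0 s) (-%R : R -> measurableTypeR R) A =
  normal_prob 0 s A.
Proof.
move=> s0 mA.
have mpdf : measurable_fun setT (fun x => (normal_pdf 0 s x)%:E).
  by apply/measurable_EFinP; exact: measurable_normal_pdf.
have mopp : measurable_fun setT (-%R : R -> measurableTypeR R).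
  by apply: continuous_measurable_fun; exact: opp_continuous.
rewrite [RHS](_ : _ = \int[pushforward mu (-%R : R -> measurableTypeR R)]_(x in A)
    (normal_pdf 0 s x)%:E).
  rewrite ge0_integral_pushforward//.
  - apply: eq_integral => x _ /=.
    by rewrite !normal_pdfE// /normal_fun !subr0 sqrrN.
  - exact: measurable_funTS.
  - by move=> x _; rewrite lee_fin normal_pdf_ge0.
by apply: eq_measure_integral => B mB _; exact/esym/lebesgue_measureN.
Qed.


(** By reflection symmetry the integral equals its own opposite; integrability makes it a real
    number, which must then be 0. *)
Lemma integral_normal_prob_id (s : R) : s != 0%R ->
  \int[normal_prob 0 s]_x x%:E = 0.
Proof.
move=> s0; have inorm := integrable_normal_prob_id s0.
have mopp : measurable_fun setT (-%R : R -> measurableTypeR R).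
  by apply: continuous_measurable_fun; exact: opp_continuous.
have : \int[normal_prob 0 s]_x x%:E = \int[normal_prob 0 s]_x (- x%:E).
  transitivity (\int[pushforward (normal_prob 0 s) (-%R : R -> measurableTypeR R)]_x x%:E).
    by apply: eq_measure_integral => A mA _; exact/esym/normal_probN.
  rewrite integral_pushforward//.
  exact: (integrableN inorm).
rewrite integralN//; last exact: integrable_add_def.
have := integrable_fin_num measurableT inorm.
case: (\int[_]_x _) => // r _ [/eqP]; rewrite -addr_eq0 -mulr2n mulrn_eq0/=.
by move/eqP ->.
Qed.

(** The real part has the law N(0, s^2 / 2), so both claims are transferred from that law by a
    change of variables. *)
Lemma expectation_cgauss_Re (d : measure_display) (T : measurableType d)
    (P : probability T R) (z : T -> R[i]) (s : R) :
  measurable_fun setT (fun w => complex.Re (z w)) -> cgauss P z s ->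
  P.-integrable setT (fun w => (complex.Re (z w))%:E) /\
  \int[P]_w (complex.Re (z w))%:E = 0.
Proof.
move=> mz [s0 [lawz _]].
have s20 : (s / Num.sqrt 2 != 0)%R by rewrite mulf_neq0 ?gt_eqF// invr_gt0 sqrtr_gt0.
have mz' : measurable_fun setT ((fun w => complex.Re (z w)) : T -> measurableTypeR R).
  exact: mz.
pose X : {mfun T >-> measurableTypeR R} := HB.pack (fun w => complex.Re (z w))
  (isMeasurableFun.Build _ _ _ _ _ mz').
have lawI (f : R -> \bar R) :
    \int[distribution P X]_x f x = \int[normal_prob 0 (s / Num.sqrt 2)]_x f x.
  by apply: eq_measure_integral => A mA _; exact: lawz.
have iX : P.-integrable setT (EFin \o X).
  apply/integrableP; split; first exact/measurable_EFinP.
  rewrite -(ge0_integral_distribution X (f := fun x => `|x%:E|))//; last first.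
    exact/measurableT_comp/measurable_EFinP.
  by rewrite lawI; case/integrableP: (integrable_normal_prob_id s20).
split => //.
rewrite -(integral_distribution (X := X) (@EFin_measurable R setT))// lawI.
exact: integral_normal_prob_id.
Qed.

End gaussian.

(** * Square-integrable random variables *)

Section square_integrable.
Set Implicit Arguments.
Unset Strict Implicit.
Context (R : realType) (d : measure_display) (T : measurableType d).
Variable P : probability T R.
Implicit Types X Y : T -> R.

(** Measurability of [X] is required separately because that of its square does not imply it. *)
Definition sqint X := measurable_fun setT X /\
  P.-integrable setT (EFin \o (fun w => X w ^+ 2)).

Lemma integrable_leR X Y : measurable_fun setT X ->
  (forall w, `|X w| <= Y w) -> P.-integrable setT (EFin \o Y) ->
  P.-integrable setT (EFin \o X).
Proof.
move=> mX XY; apply: le_integrable => //; first exact/measurable_EFinP.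
by move=> w _ /=; rewrite lee_fin; apply: le_trans (XY w) (ler_norm _).
Qed.

Lemma integrable_sumR (I : Type) (s : seq I) (X : I -> T -> R) :
  (forall i, P.-integrable setT (EFin \o X i)) ->
  P.-integrable setT (EFin \o (fun w => \sum_(i <- s) X i w)).
Proof.
move=> iX; rewrite (_ : _ \o _ = (fun w => \sum_(i <- s) (EFin \o X i) w)%E).
  exact: integrable_sum.
by apply/funext => w /=; rewrite sumEFin.
Qed.

Lemma integrableZR (a : R) X : P.-integrable setT (EFin \o X) ->
  P.-integrable setT (EFin \o (fun w => a * X w)).
Proof.
move=> iX; rewrite (_ : _ \o _ = (fun w => a%:E * (EFin \o X) w)%E).
  exact: integrableZl.
by apply/funext => w /=; rewrite EFinM.
Qed.

Lemma integrableDR X Y : P.-integrable setT (EFin \o X) ->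
  P.-integrable setT (EFin \o Y) ->
  P.-integrable setT (EFin \o (fun w => X w + Y w)).
Proof.
move=> iX iY; rewrite (_ : _ \o _ = ((EFin \o X) \+ (EFin \o Y))%E).
  exact: integrableD.
by apply/funext => w /=; rewrite EFinD.
Qed.

Lemma integrable_cstR (a : R) : P.-integrable setT (EFin \o (fun=> a)).
Proof. exact: finite_measure_integrable_cst. Qed.

Lemma sqint_le X Y : measurable_fun setT X -> (forall w, X w ^+ 2 <= Y w) ->
  P.-integrable setT (EFin \o Y) -> sqint X.
Proof.
move=> mX XY iY; split => //; apply: integrable_leR iY.
  exact: measurable_funX.
by move=> w; rewrite ger0_norm ?sqr_ge0.
Qed.

Lemma sqint_expectation X : measurable_fun setT X ->
  ('E_P[fun w => (X w ^+ 2)%R] < +oo)%E -> sqint X.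
Proof.
move=> mX; rewrite unlock => EX; split => //; apply/integrableP; split.
  exact/measurable_EFinP/measurable_funX.
by under eq_integral do rewrite /= ger0_norm ?sqr_ge0//.
Qed.

(** The product is dominated by [X ^+ 2 + Y ^+ 2], as the squares of [X - Y] and [X + Y] are
    nonnegative. *)
Lemma integrable_sqintM X Y : sqint X -> sqint Y ->
  P.-integrable setT (EFin \o (fun w => X w * Y w)).
Proof.
move=> [mX iX] [mY iY]; apply: integrable_leR (integrableDR iX iY).
  exact: measurable_funM.
by move=> w; rewrite ler_norml; have := sqr_ge0 (X w - Y w);
  have := sqr_ge0 (X w + Y w); nra.
Qed.

Lemma sqint_cst (a : R) : sqint (fun=> a).
Proof. by split; [exact: measurable_cst|exact: integrable_cstR]. Qed.

Lemma sqint_integrable X : sqint X -> P.-integrable setT (EFin \o X).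
Proof.
move=> sX; have := integrable_sqintM sX (sqint_cst 1).
by under eq_fun do rewrite /= mulr1.
Qed.

Lemma sqintD X Y : sqint X -> sqint Y -> sqint (fun w => X w + Y w).
Proof.
move=> [mX iX] [mY iY].
apply: (sqint_le _ _ (integrableZR 2 (integrableDR iX iY))).
  exact: measurable_funD.
by move=> w; have := sqr_ge0 (X w - Y w); nra.
Qed.

Lemma sqintZ (a : R) X : sqint X -> sqint (fun w => a * X w).
Proof.
move=> [mX iX]; apply: (sqint_le _ _ (integrableZR (a ^+ 2) iX)).
  exact: measurable_funM.
by move=> w; rewrite exprMn.
Qed.

Lemma sqintB X Y : sqint X -> sqint Y -> sqint (fun w => X w - Y w).
Proof.
move=> sX sY; have := sqintD sX (sqintZ (-1) sY).
by under [X in sqint X]eq_fun do rewrite mulN1r.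
Qed.

Lemma sqint_sum (I : Type) (s : seq I) (X : I -> T -> R) :
  (forall i, sqint (X i)) -> sqint (fun w => \sum_(i <- s) X i w).
Proof.
move=> sX; elim: s => [|i s IH].
  by under [X in sqint X]eq_fun do rewrite big_nil; exact: sqint_cst.
by under [X in sqint X]eq_fun do rewrite big_cons; exact: sqintD.
Qed.

End square_integrable.

(** * Euclidean geometry, Jensen's inequality and the descent lemma *)

Section euclidean.
Set Implicit Arguments.
Unset Strict Implicit.
Context (R : realType) (D : nat).
Implicit Types u v w : 'rV[R]_D.

Lemma dotvC u v : dotv u v = dotv v u.
Proof. by apply: eq_bigr => i _; rewrite mulrC. Qed.

Lemma dotvDl u v w : dotv (u + v) w = dotv u w + dotv v w.
Proof. by rewrite -big_split/=; apply: eq_bigr => i _; rewrite mxE mulrDl. Qed.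

Lemma dotvZl (a : R) u v : dotv (a *: u) v = a * dotv u v.
Proof. by rewrite mulr_sumr; apply: eq_bigr => i _; rewrite mxE mulrA. Qed.

Lemma dotvDr u v w : dotv w (u + v) = dotv w u + dotv w v.
Proof. by rewrite dotvC dotvDl !(dotvC w). Qed.

Lemma dotvZr (a : R) u v : dotv u (a *: v) = a * dotv u v.
Proof. by rewrite dotvC dotvZl dotvC. Qed.

Lemma dotvNl u v : dotv (- u) v = - dotv u v.
Proof. by rewrite -scaleN1r dotvZl mulN1r. Qed.

Lemma dotvNr u v : dotv u (- v) = - dotv u v.
Proof. by rewrite dotvC dotvNl dotvC. Qed.

Lemma dotvv u : dotv u u = \sum_(i < D) u 0 i ^+ 2.
Proof. by apply: eq_bigr => i _; rewrite expr2. Qed.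

Lemma dotv_ge0 u : 0 <= dotv u u.
Proof. by rewrite dotvv sumr_ge0// => i _; rewrite sqr_ge0. Qed.

Lemma dotvDD u v : dotv (u + v) (u + v) = dotv u u + 2 * dotv u v + dotv v v.
Proof. by rewrite dotvDl !dotvDr (dotvC v u); ring. Qed.

Lemma dotvBB u v : dotv (u - v) (u - v) = dotv u u - 2 * dotv u v + dotv v v.
Proof. by rewrite dotvDD !dotvNr dotvNl; ring. Qed.

Lemma enorm_sqr u : enorm u ^+ 2 = dotv u u.
Proof. by rewrite sqr_sqrtr// dotv_ge0. Qed.

Lemma enorm_ge0 u : 0 <= enorm u.
Proof. exact: sqrtr_ge0. Qed.

Lemma normr_le_enorm u i : `|u 0 i| <= enorm u.
Proof.
rewrite -ler_sqr ?nnegrE ?enorm_ge0// enorm_sqr real_normK ?num_real// dotvv.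
by rewrite (bigD1 i)//= lerDl sumr_ge0// => j _; rewrite sqr_ge0.
Qed.

Lemma enorm_le_sum u : enorm u <= \sum_(i < D) `|u 0 i|.
Proof.
have s0 : 0 <= \sum_(i < D) `|u 0 i| by rewrite sumr_ge0.
rewrite -ler_sqr ?nnegrE ?enorm_ge0// enorm_sqr dotvv expr2 mulr_suml.
apply: ler_sum => i _; rewrite -real_normK ?num_real// expr2 ler_wpM2l//.
by rewrite (bigD1 i)//= lerDl sumr_ge0.
Qed.

Lemma dotv_delta u i : dotv u (delta_mx 0 i) = u 0 i.
Proof.
rewrite /dotv (bigD1 i)//= mxE !eqxx mulr1 big1 ?addr0// => j ji.
by rewrite mxE (negbTE ji) andbF mulr0.
Qed.

(** This identifies a gradient from the differential that it represents. *)
Lemma dotv_inj u v : (forall w, dotv u w = dotv v w) -> u = v.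
Proof. by move=> uv; apply/rowP => i; rewrite -!dotv_delta uv. Qed.

(** Jensen's inequality for the square: the sum of squared deviations from the mean is nonnegative.
    For [K = 0] both sides vanish. *)
Lemma sqr_mean_le (K : nat) (a : 'I_K -> R) :
  (K%:R^-1 * \sum_(k < K) a k) ^+ 2 <= K%:R^-1 * \sum_(k < K) a k ^+ 2.
Proof.
case: K a => [a|K a]; first by rewrite !big_ord0 !mulr0 expr0n.
set n : R := K.+1%:R; have n0 : 0 < n by rewrite ltr0n.
set m := n^-1 * _; have sE : \sum_(k < K.+1) a k = n * m by rewrite mulrA divff ?gt_eqF// mul1r.
have : 0 <= \sum_(k < K.+1) (a k - m) ^+ 2 by rewrite sumr_ge0// => k _; rewrite sqr_ge0.
under eq_bigr do rewrite sqrrB.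
rewrite !big_split/= sumrN sumr_const card_ord -mulr_natl -/n.
under [X in _ - X + _]eq_bigr do rewrite -mulr_natl mulrA mulrC.
rewrite -!mulr_sumr sE => h.
by rewrite -(ler_pM2l n0) [n * (n^-1 * _)]mulrA divff ?gt_eqF// mul1r; nra.
Qed.

Lemma dotv_mean_le (K : nat) (a : 'I_K -> 'rV[R]_D) :
  dotv (K%:R^-1 *: \sum_(k < K) a k) (K%:R^-1 *: \sum_(k < K) a k) <=
  K%:R^-1 * \sum_(k < K) dotv (a k) (a k).
Proof.
rewrite dotvv; under [in leRHS]eq_bigr do rewrite dotvv.
rewrite exchange_big mulr_sumr/=; apply: ler_sum => i _.
by rewrite mxE summxE; exact: sqr_mean_le.
Qed.

(** The squared form keeps the later estimates polynomial in inner products, within reach of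
    [nra]. *)
Lemma sqr_lipschitz (L : R) (g : 'rV[R]_D -> 'rV[R]_D) u v : 0 < L ->
  enorm (g u - g v) <= L * enorm (u - v) ->
  dotv (g u - g v) (g u - g v) <= L ^+ 2 * dotv (u - v) (u - v).
Proof.
move=> L0 guv; rewrite -!enorm_sqr -exprMn ler_sqr// nnegrE ?enorm_ge0//.
by rewrite mulr_ge0 ?enorm_ge0// ltW.
Qed.

(** The difference quotients of the restriction to a line are those of [f] in the direction [v], so
    only the two expressions have to be matched. *)
Lemma is_derive_line (f : 'rV[R]_D -> R) (x v : 'rV[R]_D) (s : R) :
  differentiable f (x + s *: v) ->
  is_derive s 1 (fun s : R => f (x + s *: v)) ('d f (x + s *: v) v).
Proof.
move=> df; have [dfv <-] : is_derive (x + s *: v) v f ('d f (x + s *: v) v).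
  by split; [exact: diff_derivable|rewrite deriveE].
have E : (fun h : R => h^-1 *: ((f \o shift (x + s *: v)) (h *: v) - f (x + s *: v))) =
  (fun h : R => h^-1 *: (((fun s : R => f (x + s *: v)) \o shift s) (h *: (1 : R))
    - f (x + s *: v))).
  apply/funext => h /=; congr (_ *: (f _ - _)).
  by rewrite (_ : h *: (1 : R) = h) ?scalerDl 1?addrCA//; exact: mulr1.
by split; [move: dfv; rewrite /derivable E|rewrite /derive E].
Qed.

(** Along the segment from [x] to [y], [phi] is [f] minus the linear and quadratic terms of the
    bound. Its derivative is nonpositive on the open interval, and the mean value theorem gives
    [phi 1 <= phi 0]. *)
Lemma descent_lemma (L : R) (f : 'rV[R]_D -> R) (g : 'rV[R]_D -> 'rV[R]_D) :
  0 < L ->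
  (forall x, differentiable f x /\ forall v, 'd f x v = dotv (g x) v) ->
  (forall x y, dotv (g x - g y) (g x - g y) <= L ^+ 2 * dotv (x - y) (x - y)) ->
  forall x y, f y <= f x + dotv (g x) (y - x) + L / 2 * dotv (y - x) (y - x).
Proof.
move=> L0 df lip x y; set v := y - x.
pose h (s : R) := f (x + s *: v).
pose phi (s : R) := h s - s * dotv (g x) v - L / 2 * s ^+ 2 * dotv v v.
pose dphi (s : R) := dotv (g (x + s *: v)) v - dotv (g x) v - L * s * dotv v v.
have dphiE (s : R) : is_derive s 1 phi (dphi s).
  have [dfs dfE] := df (x + s *: v).
  have := is_derive_line dfs; rewrite dfE -/h => hd.
  rewrite /phi /dphi; apply: is_derive_eq.
  by rewrite /GRing.scale /=; field.
have [c] : exists2 c, c \in `]0, 1[ & phi 1 - phi 0 = dphi c * (1 - 0).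
  apply: MVT => //.
  apply: continuous_subspaceT => s.
  by apply: differentiable_continuous; apply/derivable1_diffP; case: (dphiE s).
rewrite in_itv/= subr0 mulr1 => /andP[c0 c1] phiE.
have : dphi c <= 0.
  (* Young's inequality replaces Cauchy-Schwarz: expanding the squared length of [a - (L * c) *: v]
     and bounding that of [a] by [ha] yields the sign of [L * c * dphi c]. *)
  have cL : 0 < L * c by rewrite mulr_gt0.
  have := lip (x + c *: v) x; rewrite addrAC subrr add0r dotvZl dotvZr.
  set a := g _ - g x => ha.
  have := dotv_ge0 (a - (L * c) *: v).
  rewrite dotvBB !dotvZr dotvZl => hb.
  have -> : dphi c = dotv a v - L * c * dotv v v by rewrite /dphi /a dotvDl dotvNl.
  by rewrite -(pmulr_rle0 _ cL); nra.
have xv : x + v = y by rewrite /v addrC subrK.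
by rewrite -phiE /phi /h scale1r scale0r addr0 xv; lra.
Qed.

End euclidean.

(** * Measurability of Lipschitz functions of measurable vectors *)

Section lipschitz_measurable.
Set Implicit Arguments.
Unset Strict Implicit.
Context (R : realType) (d : measure_display) (T : measurableType d) (D : nat).

(* The l^1-Lipschitz function phi is the supremum over rational q of
   phi q - C * |x - q|_1. *)
Lemma measurable_lipschitz_comp (phi : 'rV[R]_D -> R) (C : R)
    (f : T -> 'rV[R]_D) : 0 < C ->
  (forall x y, `|phi x - phi y| <= C * \sum_(i < D) `|x 0 i - y 0 i|) ->
  (forall i, measurable_fun setT (fun w => f w 0 i)) ->
  measurable_fun setT (fun w => phi (f w)).
Proof.
move=> C0 lip mf.
pose ratv (q : 'rV[rat]_D) : 'rV[R]_D := map_mx ratr q.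
pose psi (q : 'rV[rat]_D) w := phi (ratv q) - C * \sum_(i < D) `|f w 0 i - ratv q 0 i|.
have mpsi q : measurable_fun setT (psi q).
  apply: measurable_funB => //; apply: measurable_funM => //.
  apply: measurable_sum => i; apply: measurableT_comp => //.
  exact: measurable_funB.
apply: (measurability _ (RGenOInfty.measurableE R)) => //.
move=> _ [_ [a ->]] <-; rewrite setTI.
(* Rational vectors are enumerated by [unpickle]; integers that encode none contribute the empty
   set. *)
have -> : (fun w => phi (f w)) @^-1` `]a, +oo[%classic =
    \bigcup_n oapp (fun q => psi q @^-1` `]a, +oo[%classic) set0
      (unpickle n : option 'rV[rat]_D).
  apply/seteqP; split => w /=; rewrite in_itv/= andbT; last first.
    move=> [n _]; case: (unpickle n) => //= q; rewrite in_itv/= andbT => /lt_le_trans; apply.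
    rewrite /psi lerBlDr -lerBlDl; apply: le_trans (ler_norm _) _.
    rewrite distrC; apply: le_trans (lip _ _) _.
    exact: lexx.
  (* With S the l^1 distance from [f w] to q, [psi q w] is at least [phi (f w) - 2 * C * S], so
     [C * S] must stay below half the gap [phi (f w) - a]. Using [D.+1] keeps the denominator
     nonzero and the bound strict. *)
  move=> aphi; pose e := (phi (f w) - a) / (C * (D.+1%:R * 2)).
  have e0 : 0 < e by rewrite divr_gt0 ?subr_gt0// mulr_gt0// mulr_gt0.
  have [q hq] : exists q : 'rV[rat]_D, forall i, `|f w 0 i - ratv q 0 i| < e.
    have /choice[q hq] : forall i : 'I_D, exists r : rat, `|f w 0 i - ratr r| < e.
      move=> i; have [r] := @rat_in_itvoo R (f w 0 i - e) (f w 0 i + e) ltac:(lra).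
      rewrite in_itv/= => /andP[h1 h2]; exists r; rewrite ltr_norml; lra.
    by exists (\row_i q i) => i; rewrite !mxE.
  exists (pickle q) => //; rewrite pickleK/= in_itv/= andbT /psi.
  set S := \sum_(i < D) _.
  have S0 : S <= D%:R * e.
    rewrite mulr_natl -[X in e *+ X]card_ord -sumr_const; apply: ler_sum => i _.
    exact/ltW.
  have := lip (f w) (ratv q); rewrite -/S ler_norml => /andP[h1 h2].
  have De : C * (D%:R * e) < (phi (f w) - a) / 2.
    rewrite /e [ltRHS](_ : _ = C * (D.+1%:R * ((phi (f w) - a) / (C * (D.+1%:R * 2))))); last first.
      have : D.+1%:R != 0 :> R by rewrite pnatr_eq0.
      by move: (D.+1%:R) => n n0; field; rewrite n0 gt_eqF.
    by rewrite ltr_pM2l// ltr_pM2r// ltr_nat.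
  have : C * S <= C * (D%:R * e) by rewrite ler_pM2l.
  lra.
apply: bigcupT_measurable => n; case: (unpickle n) => [q|]//=.
by rewrite -[X in measurable X]setTI; exact: mpsi.
Qed.

End lipschitz_measurable.

(** * Real and imaginary parts of complex expressions *)

Section complex_measurable.
Set Implicit Arguments.
Unset Strict Implicit.
Local Open Scope complex_scope.
Context (R : realType) (d : measure_display) (T : measurableType d).

Lemma ReD (x y : R[i]) : complex.Re (x + y) = complex.Re x + complex.Re y.
Proof. by case: x; case: y. Qed.

Lemma ImD (x y : R[i]) : complex.Im (x + y) = complex.Im x + complex.Im y.
Proof. by case: x; case: y. Qed.

Lemma ReM (x y : R[i]) : complex.Re (x * y) =
  complex.Re x * complex.Re y - complex.Im x * complex.Im y.
Proof. by case: x; case: y. Qed.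

Lemma ImM (x y : R[i]) : complex.Im (x * y) =
  complex.Re x * complex.Im y + complex.Im x * complex.Re y.
Proof. by case: x; case: y. Qed.

Lemma Re_sum (I : Type) (s : seq I) (F : I -> R[i]) :
  complex.Re (\sum_(i <- s) F i) = \sum_(i <- s) complex.Re (F i).
Proof. by apply: big_morph => //; exact: ReD. Qed.

Lemma ReMC (x : R[i]) (a : R) : complex.Re (x * a%:C) = complex.Re x * a.
Proof. by rewrite ReM/= mulr0 subr0. Qed.

Lemma divr_real_complex (x : R[i]) (a : R) : x / a%:C = x * (a^-1)%:C.
Proof. by rewrite fmorphV. Qed.

(** Only real parts enter the errors, but a product mixes the two parts, so both are tracked. *)
Definition cmeasurable (f : T -> R[i]) :=
  measurable_fun setT (fun w => complex.Re (f w)) /\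
  measurable_fun setT (fun w => complex.Im (f w)).

Lemma cmeasurable_cst z : cmeasurable (fun=> z).
Proof. by split; exact: measurable_cst. Qed.

Lemma cmeasurable_real (f : T -> R) : measurable_fun setT f ->
  cmeasurable (fun w => (f w)%:C).
Proof. by split => //; exact: measurable_cst. Qed.

Lemma cmeasurableD (f g : T -> R[i]) : cmeasurable f -> cmeasurable g ->
  cmeasurable (fun w => f w + g w).
Proof.
move=> [rf imf] [rg img]; split.
  by under eq_fun do rewrite ReD; exact: measurable_funD.
by under eq_fun do rewrite ImD; exact: measurable_funD.
Qed.

Lemma cmeasurableM (f g : T -> R[i]) : cmeasurable f -> cmeasurable g ->
  cmeasurable (fun w => f w * g w).
Proof.
move=> [rf imf] [rg img]; split.
  by under eq_fun do rewrite ReM; apply: measurable_funB; exact: measurable_funM.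
by under eq_fun do rewrite ImM; apply: measurable_funD; exact: measurable_funM.
Qed.

Lemma cmeasurable_sum (I : Type) (s : seq I) (F : I -> T -> R[i]) :
  (forall i, cmeasurable (F i)) -> cmeasurable (fun w => \sum_(i <- s) F i w).
Proof.
move=> mF; elim: s => [|i s IH].
  by under [X in cmeasurable X]eq_fun do rewrite big_nil; exact: cmeasurable_cst.
by under [X in cmeasurable X]eq_fun do rewrite big_cons; exact: cmeasurableD.
Qed.

End complex_measurable.

(** * Measurability of the learning process *)

Section process_measurable.
Set Implicit Arguments.
Unset Strict Implicit.
Local Open Scope complex_scope.
Context (R : realType) (D K Mo Kx : nat) (ch : channels R K Mo Kx).
Variables (gF : 'I_K -> 'rV[R]_D -> 'rV[R]_D) (eta L : R) (w0 : 'rV[R]_D).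
Hypothesis L0 : 0 < L.
Hypothesis lipg : forall k w w', enorm (gF k w - gF k w') <= L * enorm (w - w').

(** The measurable space is a parameter: the same lemmas serve for the ambient sigma-algebra and for
    the one generated by the history. *)
Definition coord_measurable (d : measure_display) (T : measurableType d)
  (f : T -> 'rV[R]_D) := forall i, measurable_fun setT (fun w => f w 0 i).

(** The l^1 form of the Lipschitz bound, as [measurable_lipschitz_comp] requires it. *)
Lemma gF_coord_lip k i x y :
  `|gF k x 0 i - gF k y 0 i| <= L * \sum_(j < D) `|x 0 j - y 0 j|.
Proof.
have -> : gF k x 0 i - gF k y 0 i = (gF k x - gF k y) 0 i by rewrite !mxE.
apply: le_trans (normr_le_enorm _ _) _; apply: le_trans (lipg _ _ _) _.
rewrite ler_pM2l//; apply: le_trans (enorm_le_sum _) _.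
by apply: ler_sum => j _; rewrite !mxE.
Qed.

Context (d : measure_display) (T : measurableType d).
Variable rv : randomness R T D K Mo Kx.

Lemma measurable_gF k (f : T -> 'rV[R]_D) : coord_measurable f ->
  coord_measurable (fun w => gF k (f w)).
Proof.
move=> mf i; apply: (measurable_lipschitz_comp (phi := fun y => gF k y 0 i) L0) => //.
by move=> x y; exact: gF_coord_lip.
Qed.

Lemma measurable_stdv (f : T -> 'rV[R]_D) : coord_measurable f ->
  measurable_fun setT (fun w => stdv (f w)).
Proof.
move=> mf; apply: (@measurableT_comp _ _ _ _ _ _ (@Num.sqrt R)).
  by apply: continuous_measurable_fun; exact: sqrt_continuous.
apply: measurable_funM => //; apply: measurable_sum => i.
apply: measurable_funX; apply: measurable_funB => //.
by apply: measurable_funM => //; exact: measurable_sum.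
Qed.

Lemma measurable_what t k (wp : T -> 'rV[R]_D) :
  (forall f, dl_family rv t f -> measurable_fun setT f) ->
  coord_measurable wp -> coord_measurable (fun w => what ch rv t (wp w) k w).
Proof.
move=> mdl mwp i; under eq_fun do rewrite !mxE; apply: measurable_funD => //.
suff : cmeasurable (fun w => edl_c ch rv t k (stdv (wp w)) i w) by case.
apply: cmeasurableM.
  apply: cmeasurableM; last exact: cmeasurable_cst.
  apply: cmeasurableM; first exact: cmeasurable_cst.
  exact/cmeasurable_real/measurable_stdv.
apply: cmeasurableD.
  apply: cmeasurable_sum => l; apply: cmeasurableM; first exact: cmeasurable_cst.
  apply/cmeasurable_real/measurable_funM => //.
  by apply: mdl; left; exists l, i.
by split; apply: mdl; right; exists k, i; [left|right].
Qed.

Lemma measurable_eulRe_of t (wp : T -> 'rV[R]_D) :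
  (forall f, dl_family rv t f \/ ul_family rv t f -> measurable_fun setT f) ->
  coord_measurable wp -> coord_measurable (fun w => eulRe_of ch rv gF t (wp w) w).
Proof.
move=> mf mwp i; under eq_fun do rewrite !mxE.
suff : cmeasurable (fun w => eul_c ch rv t (ups ch rv gF t (wp w) w) i w) by case.
have mdl f : dl_family rv t f -> measurable_fun setT f by move=> ?; apply: mf; left.
have mul f : ul_family rv t f -> measurable_fun setT f by move=> ?; apply: mf; right.
apply: cmeasurableD; first apply: cmeasurableD.
- apply: cmeasurable_sum => k; apply/cmeasurable_real/measurable_funM.
    apply: measurable_funB => //; apply: measurable_stdv; apply: measurable_gF.
    exact: measurable_what.
  by apply: mul; left; exists k, i.
- apply: cmeasurableM; last exact: cmeasurable_cst.
  by split; apply: mul; right; right; exists i; [left|right].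
- apply: cmeasurable_sum => k; apply: cmeasurableM; last exact: cmeasurable_cst.
  apply: cmeasurableM; first exact: cmeasurable_cst.
  apply/cmeasurable_real/measurable_funM => //.
  by apply: mul; right; left; exists k, i.
Qed.

Lemma hist_familyS t f : hist_family rv t f -> hist_family rv t.+1 f.
Proof.
move=> [s [[/andP[s1 st] h]|[/andP[s1 st] h]]]; exists s; [left|right]; split => //.
  by rewrite s1 ltnW.
by rewrite s1 ltnW.
Qed.

Lemma hist_family_dl t f : dl_family rv t.+1 f -> hist_family rv t.+1 f.
Proof. by move=> h; exists t.+1; left; rewrite leqnn. Qed.

(** The uplink of a round enters the history one round later, whereas its downlink is already in the
    history of the same round. *)
Lemma hist_family_ul t f : ul_family rv t.+1 f -> hist_family rv t.+2 f.
Proof. by move=> h; exists t.+1; right; rewrite leqnn. Qed.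

(** The model after round t depends on rounds 1 to t only, all contained in the history of round
    t+1. Measurability is assumed for that family alone, so that its own sigma-algebra may be
    substituted later. *)
Lemma measurable_wproc t :
  (forall f, hist_family rv t.+1 f -> measurable_fun setT f) ->
  coord_measurable (wproc ch rv gF eta w0 t).
Proof.
elim: t => [|t IH] mh; first by move=> i; exact: measurable_cst.
have mw : coord_measurable (wproc ch rv gF eta w0 t).
  by apply: IH => f hf; apply: mh; exact: hist_familyS.
have mdl f : dl_family rv t.+1 f -> measurable_fun setT f.
  by move=> ?; apply: mh; exact/hist_familyS/hist_family_dl.
have mul f : ul_family rv t.+1 f -> measurable_fun setT f.
  by move=> ?; apply: mh; exact: hist_family_ul.
move=> i /=; rewrite (_ : (fun w => _) = (fun w => wproc ch rv gF eta w0 t w 0 i -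
    eta * (K%:R^-1 * (\sum_(k < K) glocal ch rv gF t.+1 (wproc ch rv gF eta w0 t w) k w 0 i +
    eulRe_of ch rv gF t.+1 (wproc ch rv gF eta w0 t w) w 0 i)))); last first.
  by apply/funext => w; rewrite !mxE summxE.
apply: measurable_funB => //; apply: measurable_funM => //.
apply: measurable_funM => //; apply: measurable_funD.
  by apply: measurable_sum => k; apply: measurable_gF; exact: measurable_what.
by apply: measurable_eulRe_of => // f [/mdl|/mul].
Qed.

End process_measurable.

(** * Quantities known before the uplink, and independence from it *)

Section history.
Set Implicit Arguments.
Unset Strict Implicit.
Local Open Scope complex_scope.
Context (R : realType) (d : measure_display) (T : measurableType d).
Variable P : probability T R.
Context (D K Mo Kx : nat) (ch : channels R K Mo Kx).
Variables (gF : 'I_K -> 'rV[R]_D -> 'rV[R]_D) (eta L : R) (w0 : 'rV[R]_D).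
Hypothesis L0 : 0 < L.
Hypothesis lipg : forall k w w', enorm (gF k w - gF k w') <= L * enorm (w - w').
Variable rv : randomness R T D K Mo Kx.

(** The generators of [sigma_gen fam], isolated so that the generated sigma-algebra can serve as a
    measurable space. *)
Definition preimages (fam : set (T -> R)) : set (set T) :=
  [set A | exists f B, fam f /\ measurable B /\ A = f @^-1` B].

Definition gen_measurable (fam : set (T -> R)) (X : T -> R) :=
  measurable_fun (setT : set (g_sigma_algebraType (preimages fam))) X.

Lemma gen_measurable_mem (fam : set (T -> R)) f : fam f -> gen_measurable fam f.
Proof.
move=> ff _ B mB; rewrite setTI; apply: sub_sigma_algebra.
by exists f, B.
Qed.

Lemma gen_measurableW (fam : set (T -> R)) X :
  (forall f, fam f -> measurable_fun setT f) ->
  gen_measurable fam X -> measurable_fun setT X.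
Proof.
move=> mfam mX _ B mB; have := mX measurableT B mB.
apply: smallest_sub; first exact: sigma_algebra_measurable.
move=> _ [f [C [ff [mC ->]]]]; rewrite -[X in measurable X]setTI.
exact: mfam.
Qed.

(** Events about [Y] lie in the first sigma-algebra and events about [X] in the second, so the two
    variables are independent and the expectation of the product factors through that of [Y]. *)
Lemma indep_mean0 (fam1 fam2 : set (T -> R)) (X Y : T -> R) :
  (forall f, fam1 f -> measurable_fun setT f) ->
  (forall f, fam2 f -> measurable_fun setT f) ->
  indep_sigma P (sigma_gen fam1) (sigma_gen fam2) ->
  fam1 Y -> gen_measurable fam2 X ->
  P.-integrable setT (EFin \o X) -> P.-integrable setT (EFin \o Y) ->
  (\int[P]_w (Y w)%:E = 0)%E ->
  P.-integrable setT (EFin \o (fun w => X w * Y w)) /\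
  (\int[P]_w (X w * Y w)%:E = 0)%E.
Proof.
move=> m1 m2 ind Y1 X2 iX iY Y0.
have mX := gen_measurableW m2 X2; have mY := m1 _ Y1.
pose X' : {mfun T >-> R} := HB.pack X (isMeasurableFun.Build _ _ _ _ _ mX).
pose Y' : {mfun T >-> R} := HB.pack Y (isMeasurableFun.Build _ _ _ _ _ mY).
have [] := @independent_integrableM R d T P X' Y' _ iX iY.
  move=> A B mA mB; rewrite setIC muleC; apply: ind.
    by rewrite /sigma_gen; apply: sub_sigma_algebra; exists Y, B.
  have := X2 measurableT A mA; rewrite setTI; exact.
by move=> ?; rewrite Y0 mule0.
Qed.

Local Notation wt := (wproc ch rv gF eta w0).
Local Notation gt t := (fun k w => glocal ch rv gF t.+1 (wt t w) k w).

(** The symbols are real, so taking real parts only affects the coefficients. The error becomes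
    linear in the uplink variables of the round; the only random coefficients are those containing
    the standard deviations of the local gradients. *)
Lemma eulReE t dd w : eulRe ch rv gF eta w0 t.+1 dd w =
  \sum_(k < K) ((cabs (hul ch t.+1 k) * Num.sqrt (pul ch t.+1 k) / Num.sqrt (cul ch t.+1)
     - stdv (glocal ch rv gF t.+1 (wt t w) k w)) * sul rv t.+1 k dd w)
  + (Num.sqrt (cul ch t.+1))^-1 * complex.Re (zul rv t.+1 dd w)
  + \sum_(k' < Kx) (complex.Re (hulx ch t.+1 k' * (hulh ch t.+1 k')^*) *
       Num.sqrt (pulx ch t.+1 k') / (cabs (hulh ch t.+1 k') * Num.sqrt (cul ch t.+1)))
     * sulx rv t.+1 k' dd w.
Proof.
rewrite /eulRe /eulRe_of mxE /eul_c !ReD !Re_sum; congr (_ + _ + _).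
- by rewrite divr_real_complex ReMC mulrC.
- by apply: eq_bigr => k _; rewrite divr_real_complex !ReMC; ring.
Qed.

Lemma gen_measurable_wproc t i :
  gen_measurable (hist_family rv t.+1) (fun w => wt t w 0 i).
Proof.
by apply: (measurable_wproc ch eta w0 L0 lipg) => f; exact: gen_measurable_mem.
Qed.

(** The history of round t+1 includes its downlink, so the local gradients are already determined
    before the uplink. *)
Lemma gen_measurable_glocal t k :
  forall i, gen_measurable (hist_family rv t.+1) (fun w => gt t k w 0 i).
Proof.
apply: (measurable_gF L0 lipg).
apply: (@measurable_what _ _ _ _ _ ch _
  (g_sigma_algebraType (preimages (hist_family rv t.+1))) rv).
  by move=> f hf; apply: gen_measurable_mem; exact: hist_family_dl.
exact: gen_measurable_wproc.
Qed.

Lemma gen_measurable_ups t k :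
  gen_measurable (hist_family rv t.+1) (fun w => stdv (gt t k w)).
Proof. apply: measurable_stdv; exact: gen_measurable_glocal. Qed.

End history.

(** * The global gradient and one step of noisy descent *)

Section gradient.
Set Implicit Arguments.
Unset Strict Implicit.
Context (R : realType) (D K : nat).
Variables (F : 'I_K -> 'rV[R]_D -> R) (gF : 'I_K -> 'rV[R]_D -> 'rV[R]_D).
Variables (gFm : 'rV[R]_D -> 'rV[R]_D) (L : R).
Hypothesis K0 : (0 < K)%N.
Hypothesis L0 : 0 < L.
Hypothesis dF : forall k w,
  differentiable (F k) w /\ forall v : 'rV[R]_D, 'd (F k) w v = dotv (gF k w) v.
Hypothesis lipg : forall k w w', enorm (gF k w - gF k w') <= L * enorm (w - w').
Hypothesis dFm : forall w,
  differentiable (Fglob F) w /\ forall v : 'rV[R]_D, 'd (Fglob F) w v = dotv (gFm w) v.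

Lemma dotv_suml (u : 'I_K -> 'rV[R]_D) v :
  dotv (\sum_(k < K) u k) v = \sum_(k < K) dotv (u k) v.
Proof.
rewrite /dotv exchange_big/=; apply: eq_bigr => i _.
by rewrite summxE mulr_suml.
Qed.

(** The differential is linear in the function, and a gradient is determined by its inner
    products. *)
Lemma gradient_Fglob w : gFm w = K%:R^-1 *: \sum_(k < K) gF k w.
Proof.
apply: dotv_inj => v; rewrite -(dFm w).2 dotvZl dotv_suml.
have FE : Fglob F = K%:R^-1 *: \sum_(k < K) F k.
  by apply/funext => x; rewrite /Fglob /= fctE fct_sumE.
have ds : differentiable (\sum_(k < K) F k) w.
  by apply: differentiable_sum => k; case: (dF k w).
rewrite FE diffZ//= -deriveE// derive_sum.
  congr (_ *: _); apply: eq_bigr => k _; rewrite deriveE; first exact: (dF k w).2.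
  exact: (dF k w).1.
by move=> k; apply: diff_derivable; exact: (dF k w).1.
Qed.

(** By Jensen's inequality, averaging the local gradients preserves the constant [L]. *)
Lemma sqr_lipschitz_gFm x y :
  dotv (gFm x - gFm y) (gFm x - gFm y) <= L ^+ 2 * dotv (x - y) (x - y).
Proof.
rewrite !gradient_Fglob -scalerBr -sumrB; apply: le_trans (dotv_mean_le _) _.
apply: (@le_trans _ _ (K%:R^-1 * \sum_(k < K) L ^+ 2 * dotv (x - y) (x - y))).
  rewrite ler_wpM2l ?invr_ge0//; apply: ler_sum => k _; exact: sqr_lipschitz.
by rewrite sumr_const card_ord -[(_ * _) *+ K]mulr_natl mulKf// pnatr_eq0 -lt0n.
Qed.

(* Here [a k] are the downlink errors and [e] is the uplink error; the last term
   is the one that vanishes in expectation. *)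
Lemma noisy_descent_step (eta : R) (x e g : 'rV[R]_D) (a : 'I_K -> 'rV[R]_D) :
  0 < eta < L^-1 ->
  g = K%:R^-1 *: \sum_(k < K) gF k (x + a k) ->
  Fglob F (x - eta *: (K%:R^-1 *: (\sum_(k < K) gF k (x + a k) + e))) <=
  Fglob F x - eta / 2 * dotv (gFm x) (gFm x)
  + eta / 2 * (L ^+ 2 / K%:R * \sum_(k < K) dotv (a k) (a k)
               + L * eta / K%:R ^+ 2 * dotv e e)
  + eta / K%:R * dotv ((L * eta) *: g - gFm x) e.
Proof.
move=> /andP[eta0 etaL] gE.
have K0' : 0 < K%:R :> R by rewrite ltr0n.
have etaL1 : L * eta <= 1 by rewrite mulrC -ler_pdivlMr// div1r ltW.
set y := x - _.
have yx : y - x = - (eta *: (g + K%:R^-1 *: e)).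
  by rewrite /y addrAC subrr add0r gE -scalerDr.
have := descent_lemma L0 dFm sqr_lipschitz_gFm x y.
rewrite yx (_ : dotv (gFm x) _ = - eta * (dotv (gFm x) g + K%:R^-1 * dotv (gFm x) e)); last first.
  by rewrite dotvNr dotvZr dotvDr dotvZr mulNr.
rewrite (_ : dotv (- _) _ = eta ^+ 2 * (dotv g g + 2 * (K%:R^-1 * dotv g e)
    + K%:R^-1 ^+ 2 * dotv e e)); last first.
  by rewrite dotvNr dotvNl dotvZl dotvZr dotvDD !dotvZr dotvZl; ring.
rewrite dotvDl dotvNl dotvZl => hdesc.
(* The bias of the averaged gradient comes from evaluating each local gradient at a perturbed point,
   so Jensen and the Lipschitz bound control it by the downlink errors. *)
have hlip : dotv (gFm x - g) (gFm x - g) <= L ^+ 2 / K%:R * \sum_(k < K) dotv (a k) (a k).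
  rewrite gE gradient_Fglob -scalerBr -sumrB; apply: le_trans (dotv_mean_le _) _.
  rewrite [leRHS]mulrAC mulrC ler_wpM2r ?invr_ge0// mulr_sumr.
  apply: ler_sum => k _; apply: le_trans (sqr_lipschitz L0 (lipg _ _ _)) _.
  by rewrite opprD addrA subrr add0r dotvNl dotvNr opprK.
rewrite dotvBB in hlip.
apply: le_trans hdesc _.
(* Polarizing [dotv (gFm x) g] leaves the squared length of [g] with coefficient
   [- eta / 2 * (1 - L * eta)]; the step-size condition allows this term to be dropped. *)
have g0 : 0 <= eta / 2 * (1 - L * eta) * dotv g g.
  by rewrite mulr_ge0 ?dotv_ge0// mulr_ge0 ?subr_ge0// divr_ge0// ltW.
have h2 := ler_wpM2l (ltW (divr_gt0 eta0 (ltr0n _ 2))) hlip.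
set A := L ^+ 2 / K%:R * _ in h2 *.
rewrite -subr_ge0 in h2 *; move: g0 h2.
set gg := dotv g g; set gm := dotv (gFm x) (gFm x); set mg := dotv (gFm x) g.
set me := dotv (gFm x) e; set ge := dotv g e; set ee := dotv e e.
rewrite exprVn; set ki := K%:R^-1 => g0 h2; nra.
Qed.

End gradient.

(** * Integrable random variables of mean zero *)

Section mean_zero.
Set Implicit Arguments.
Unset Strict Implicit.
Context (R : realType) (d : measure_display) (T : measurableType d).
Variable P : probability T R.
Implicit Types X Y : T -> R.
Local Notation intP X := (P.-integrable setT (EFin \o X)).

Lemma expectD X Y : intP X -> intP Y ->
  ('E_P[fun w => (X w + Y w)%R] = 'E_P[X] + 'E_P[Y])%E.
Proof. by move=> iX iY; rewrite -expectationD//; exact/Lfun1_integrable. Qed.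

Lemma expectZ (a : R) X : intP X ->
  ('E_P[fun w => (a * X w)%R] = a%:E * 'E_P[X])%E.
Proof.
move=> iX; rewrite -expectationZl//; last exact/Lfun1_integrable.
by congr expectation; apply/funext => w /=; rewrite mulrC.
Qed.

Lemma expect_sum (I : Type) (s : seq I) (X : I -> T -> R) :
  (forall i, intP (X i)) ->
  ('E_P[fun w => (\sum_(i <- s) X i w)%R] = \sum_(i <- s) 'E_P[X i])%E.
Proof.
move=> iX; elim: s => [|i s IH].
  rewrite big_nil -[RHS](expectation_cst P 0).
  by congr expectation; apply/funext => w; rewrite big_nil.
rewrite big_cons -IH -expectD//; last exact: integrable_sumR.
by congr expectation; apply/funext => w; rewrite big_cons.
Qed.

(** Integrability is included because it makes expectation additive, hence the class stable under
    sums. *)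
Definition mean0 X := intP X /\ ('E_P[X] = 0)%E.

Lemma mean0D X Y : mean0 X -> mean0 Y -> mean0 (fun w => X w + Y w).
Proof.
move=> [iX X0] [iY Y0]; split; first exact: integrableDR.
by rewrite expectD// X0 Y0 adde0.
Qed.

Lemma mean0Z (a : R) X : mean0 X -> mean0 (fun w => a * X w).
Proof.
move=> [iX X0]; split; first exact: integrableZR.
by rewrite expectZ// X0 mule0.
Qed.

Lemma mean0_sum (I : Type) (s : seq I) (X : I -> T -> R) :
  (forall i, mean0 (X i)) -> mean0 (fun w => \sum_(i <- s) X i w).
Proof.
move=> mX; split; first by apply: integrable_sumR => i; case: (mX i).
rewrite expect_sum; last by move=> i; case: (mX i).
by apply: big1 => i _; case: (mX i).
Qed.

End mean_zero.

(** * Square integrability along the recursion and vanishing of the cross term *)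

Section convergence.
Set Implicit Arguments.
Unset Strict Implicit.
Context (R : realType) (d : measure_display) (T : measurableType d).
Variable P : probability T R.
Context (D K Mo Kx : nat) (ch : channels R K Mo Kx).
Variables (gF : 'I_K -> 'rV[R]_D -> 'rV[R]_D) (eta L : R) (w0 : 'rV[R]_D).
Hypothesis L0 : 0 < L.
Hypothesis lipg : forall k w w', enorm (gF k w - gF k w') <= L * enorm (w - w').
Variable rv : randomness R T D K Mo Kx.
Hypothesis mrv : forall f, all_family rv f -> measurable_fun setT f.

Local Notation wt := (wproc ch rv gF eta w0).
Local Notation gt t := (fun k w => glocal ch rv gF t.+1 (wt t w) k w).
Local Notation edl := (edlRe ch rv gF eta w0).
Local Notation eul := (eulRe ch rv gF eta w0).

Lemma hist_measurable t f : hist_family rv t f -> measurable_fun setT f.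
Proof.
by move=> [s [[_ h]|[_ h]]]; apply: mrv; exists s; [left|right].
Qed.

Lemma ul_measurable t f : ul_family rv t f -> measurable_fun setT f.
Proof. by move=> h; apply: mrv; exists t; right. Qed.

Lemma sqint_dom (X Y : T -> R) : measurable_fun setT X ->
  (forall w, `|X w| <= Y w) -> sqint P Y -> sqint P X.
Proof.
move=> mX XY [_ iY]; apply: (sqint_le mX _ iY) => w.
rewrite -real_normK ?num_real// ler_sqr ?nnegrE//.
exact: le_trans (XY w).
Qed.

Lemma sqint_norm (X : T -> R) : sqint P X -> sqint P (fun w => `|X w|).
Proof.
move=> [mX iX]; split; first exact: measurableT_comp.
by under [X in P.-integrable _ X]eq_fun do rewrite /= real_normK ?num_real//.
Qed.

(** A Lipschitz map grows at most linearly away from its value at 0. *)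
Lemma sqint_gF k (f : T -> 'rV[R]_D) : (forall i, sqint P (fun w => f w 0 i)) ->
  forall i, sqint P (fun w => gF k (f w) 0 i).
Proof.
move=> sf i.
have mg : measurable_fun setT (fun w => gF k (f w) 0 i).
  by apply: (measurable_gF L0 lipg) => j; case: (sf j).
apply: (sqint_dom (Y := fun w => `|gF k 0 0 i| + L * \sum_(j < D) `|f w 0 j|) mg).
  move=> w; rewrite -lerBlDl; apply: le_trans (lerB_dist _ _) _.
  apply: le_trans (gF_coord_lip L0 lipg k i (f w) 0) _.
  by under eq_bigr do rewrite mxE subr0.
apply: sqintD; first exact: sqint_cst.
by apply: sqintZ; apply: sqint_sum => j; exact: sqint_norm.
Qed.

Lemma sqint_stdv (f : T -> 'rV[R]_D) : (forall i, sqint P (fun w => f w 0 i)) ->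
  sqint P (fun w => stdv (f w)).
Proof.
move=> sf; have smean : sqint P (fun w => meanv (f w)).
  by apply: sqintZ; exact: sqint_sum.
apply: (sqint_le (Y := fun w => (D%:R)^-1 * \sum_(i < D) (f w 0 i - meanv (f w)) ^+ 2)).
- by apply: measurable_stdv => i; case: (sf i).
- move=> w; rewrite sqr_sqrtr// mulr_ge0 ?invr_ge0// sumr_ge0// => i _.
  exact: sqr_ge0.
- by apply: integrableZR; apply: integrable_sumR => i; case: (sqintB (sf i) smean).
Qed.

Variable N : nat.
Hypothesis sdl : forall t, (t < N)%N -> forall k i, sqint P (edl t.+1 k i).
Hypothesis sul2 : forall t, (t < N)%N -> forall i, sqint P (eul t.+1 i).

Lemma sqint_glocal_of t : (t < N)%N -> (forall i, sqint P (fun w => wt t w 0 i)) ->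
  forall k i, sqint P (fun w => gt t k w 0 i).
Proof.
move=> tN sw k; apply: sqint_gF => i.
under [X in sqint _ X]eq_fun do rewrite !mxE.
by apply: sqintD => //; exact: sdl.
Qed.

(** The model of round t+1 is a linear combination of the previous model, local gradients and uplink
    error. Error moments are controlled for [t < N] only, so the induction reaches round [N] and
    stops there. *)
Lemma sqint_wproc t : (t <= N)%N -> forall i, sqint P (fun w => wt t w 0 i).
Proof.
elim: t => [|t IH] tN i; first exact: sqint_cst.
have sw := IH (ltnW tN).
rewrite (_ : (fun w => _) = (fun w => wt t w 0 i -
    eta * (K%:R^-1 * (\sum_(k < K) gt t k w 0 i + eul t.+1 i w)))); last first.
  by apply/funext => w /=; rewrite /eulRe !mxE summxE.
apply: sqintB => //; apply: sqintZ; apply: sqintZ; apply: sqintD; last exact: sul2.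
by apply: sqint_sum => k; exact: sqint_glocal_of.
Qed.

Lemma sqint_glocal t : (t < N)%N -> forall k i, sqint P (fun w => gt t k w 0 i).
Proof. by move=> tN; apply: sqint_glocal_of => //; apply: sqint_wproc; exact: ltnW. Qed.

Hypothesis sul_mean0 : forall t k dd, mean0 P (sul rv t k dd).
Hypothesis sulx_mean0 : forall t k dd, mean0 P (sulx rv t k dd).
Hypothesis zul_mean0 : forall t dd, mean0 P (fun w => complex.Re (zul rv t dd w)).
Hypothesis ind : forall t, (1 <= t)%N ->
  indep_sigma P (sigma_gen (ul_family rv t)) (sigma_gen (hist_family rv t)).

Lemma mean0_hist_ul t X Y : gen_measurable (hist_family rv t.+1) X ->
  ul_family rv t.+1 Y -> P.-integrable setT (EFin \o X) -> mean0 P Y ->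
  mean0 P (fun w => X w * Y w).
Proof.
move=> hX uY iX [iY]; rewrite /mean0 unlock => Y0.
exact: (indep_mean0 (@ul_measurable t.+1) (@hist_measurable t.+1) (ind _) uY hX).
Qed.

(** After expansion by [eulReE], every summand is a history-measurable factor times a centred uplink
    variable of the round. *)
Lemma mean0_eul t X i : (t < N)%N -> gen_measurable (hist_family rv t.+1) X ->
  sqint P X -> mean0 P (fun w => X w * eul t.+1 i w).
Proof.
move=> tN hX sX; have iX := sqint_integrable sX.
under [Z in mean0 _ Z]eq_fun do rewrite eulReE !mulrDr !mulr_sumr.
apply: mean0D; first apply: mean0D.
(* The standard deviation is random, so it joins [X] in the history factor, integrable as a product
   of two square-integrable variables. In the other two groups the coefficients are constants and
   come out. *)
- apply: mean0_sum => k; under [Z in mean0 _ Z]eq_fun do rewrite mulrA.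
  apply: (mean0_hist_ul (t := t)) => //.
  + apply: measurable_funM => //; apply: measurable_funB => //.
    exact: (gen_measurable_ups ch eta w0 L0 lipg).
  + by left; exists k, i.
  + apply: integrable_sqintM => //; apply: sqintB; first exact: sqint_cst.
    by apply: sqint_stdv; exact: sqint_glocal.
- under [Z in mean0 _ Z]eq_fun do rewrite mulrCA.
  apply: mean0Z; apply: (mean0_hist_ul (t := t)) => //.
  by right; right; exists i; left.
- apply: mean0_sum => k; under [Z in mean0 _ Z]eq_fun do rewrite mulrCA.
  apply: mean0Z; apply: (mean0_hist_ul (t := t)) => //.
  by right; left; exists k, i.
Qed.

End convergence.

(** * Summing the descent inequality along one trajectory *)

Section telescope.
Set Implicit Arguments.
Unset Strict Implicit.
Context (R : realType) (T : Type) (D K Mo Kx : nat) (ch : channels R K Mo Kx).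
Variables (F : 'I_K -> 'rV[R]_D -> R) (gF : 'I_K -> 'rV[R]_D -> 'rV[R]_D).
Variables (gFm : 'rV[R]_D -> 'rV[R]_D) (L eta : R) (w0 wstar : 'rV[R]_D).
Hypothesis K0 : (0 < K)%N.
Hypothesis low : forall w, Fglob F wstar <= Fglob F w.
Hypothesis L0 : 0 < L.
Hypothesis dF : forall k w,
  differentiable (F k) w /\ forall v : 'rV[R]_D, 'd (F k) w v = dotv (gF k w) v.
Hypothesis lipg : forall k w w', enorm (gF k w - gF k w') <= L * enorm (w - w').
Hypothesis dFm : forall w,
  differentiable (Fglob F) w /\ forall v : 'rV[R]_D, 'd (Fglob F) w v = dotv (gFm w) v.
Hypothesis etaL : 0 < eta < L^-1.
Variable rv : randomness R T D K Mo Kx.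

Local Notation wt := (wproc ch rv gF eta w0).
Local Notation gt t := (fun k w => glocal ch rv gF t.+1 (wt t w) k w).
Local Notation edl := (edlRe ch rv gF eta w0).
Local Notation eul := (eulRe ch rv gF eta w0).

Definition noise t (w : T) (dd : 'I_D) : R :=
  L ^+ 2 / K%:R * \sum_(k < K) edl t.+1 k dd w ^+ 2
  + L * eta / K%:R ^+ 2 * eul t.+1 dd w ^+ 2.

(** The coefficient of the uplink error in [noisy_descent_step], after multiplication of that
    inequality by [2 / eta]. *)
Definition cross_coef t (w : T) (dd : 'I_D) : R :=
  2 / K%:R * (L * eta * (K%:R^-1 * \sum_(k < K) gt t k w 0 dd) - gFm (wt t w) 0 dd).

Lemma sum_gradient_le n w :
  \sum_(t < n) enorm (gFm (wt t w)) ^+ 2 <=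
  2 / eta * (Fglob F w0 - Fglob F wstar) +
  \sum_(t < n) \sum_(dd < D) noise t w dd +
  \sum_(t < n) \sum_(dd < D) cross_coef t w dd * eul t.+1 dd w.
Proof.
have /andP[eta0 _] := etaL.
have K0' : K%:R != 0 :> R by rewrite pnatr_eq0 -lt0n.
(* Keeping the current loss on the left makes the induction telescope; the lower bound on the loss
   is applied once, at the end. *)
suff h : 2 / eta * Fglob F (wt n w) + \sum_(t < n) enorm (gFm (wt t w)) ^+ 2 <=
    2 / eta * Fglob F w0 + \sum_(t < n) \sum_(dd < D) noise t w dd +
    \sum_(t < n) \sum_(dd < D) cross_coef t w dd * eul t.+1 dd w.
  have : 2 / eta * Fglob F wstar <= 2 / eta * Fglob F (wt n w).
    by rewrite ler_wpM2l// divr_ge0// ltW.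
  by rewrite mulrBr; lra.
elim: n => [|n IH]; first by rewrite !big_ord0 !addr0.
rewrite !big_ord_recr/=.
pose a k := \row_(dd < D) edl n.+1 k dd w.
pose e := \row_(dd < D) eul n.+1 dd w.
have aE k : dotv (a k) (a k) = \sum_(dd < D) edl n.+1 k dd w ^+ 2.
  by rewrite dotvv; apply: eq_bigr => i _; rewrite mxE.
have eE : dotv e e = \sum_(dd < D) eul n.+1 dd w ^+ 2.
  by rewrite dotvv; apply: eq_bigr => i _; rewrite mxE.
have := noisy_descent_step K0 L0 dF lipg dFm (x := wt n w) e (a := a) etaL erefl.
have -> : wt n w - eta *: (K%:R^-1 *: (\sum_(k < K) gF k (wt n w + a k) + e)) = wt n.+1 w.
  rewrite /=; congr (_ - _ *: (_ *: (_ + _))).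
  by apply/rowP => i; rewrite mxE /eulRe.
set c := dotv (_ - _) e; set m := dotv (gFm _) (gFm _).
have -> : \sum_(dd < D) noise n w dd =
    L ^+ 2 / K%:R * \sum_(k < K) dotv (a k) (a k) + L * eta / K%:R ^+ 2 * dotv e e.
  rewrite big_split/= -!mulr_sumr eE exchange_big/=.
  by congr (_ * _ + _); apply: eq_bigr => k _; rewrite aE.
have -> : \sum_(dd < D) cross_coef n w dd * eul n.+1 dd w = 2 / K%:R * c.
  rewrite /c /dotv mulr_sumr; apply: eq_bigr => i _.
  by rewrite mulrA !mxE summxE.
rewrite -/(wt n.+1) enorm_sqr -/m; set f1 := Fglob F (wt n.+1 w).
set f0 := Fglob F (wt n w) in IH *.
set A := _ + L * eta / _ * _ => /(ler_wpM2l (ltW (divr_gt0 (ltr0n _ 2) eta0))).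
rewrite [leRHS](_ : _ = 2 / eta * f0 - m + A + 2 / K%:R * c); last first.
  by field; rewrite K0' gt_eqF.
lra.
Qed.

End telescope.

(** * Extracting finite terms from finite extended-real expressions *)

Section ereal_sums.
Set Implicit Arguments.
Unset Strict Implicit.
Local Open Scope ereal_scope.
Context (R : realType).

Lemma sume_lty (I : finType) (f : I -> \bar R) : (forall i, 0 <= f i) ->
  \sum_i f i < +oo -> forall i, f i < +oo.
Proof.
move=> f0 fy i; apply: le_lt_trans fy; rewrite (bigD1 i)//= leeDl//.
by apply: sume_ge0 => j _.
Qed.

Lemma mule_lty (a : R) (x : \bar R) : (0 < a)%R -> a%:E * x < +oo -> x < +oo.
Proof.
by move=> a0; case: x => [r _|/=|//]; rewrite ?ltry// gt0_muley ?lte_fin.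
Qed.

End ereal_sums.

(** * Taking expectations in the trajectory bound *)

Theorem theorem1
  (R : realType) (d : measure_display) (Omega : measurableType d)
  (P : probability Omega R)
  (D K Mo Kx : nat) (HK : (0 < K)%N)
  (F : 'I_K -> 'rV[R]_D -> R) (gF : 'I_K -> 'rV[R]_D -> 'rV[R]_D)
  (gFm : 'rV[R]_D -> 'rV[R]_D) (L : R) (wstar : 'rV[R]_D)
  (* (i) F_m lower bounded, attained at wstar *)
  (Hlow : forall w : 'rV[R]_D, Fglob F wstar <= Fglob F w)
  (* (ii) every F_{m,k} differentiable with gradient gF k, L-Lipschitz, L > 0 *)
  (HL : 0 < L)
  (HgF : forall (k : 'I_K) (w : 'rV[R]_D),
      differentiable (F k) w /\ forall v : 'rV[R]_D, 'd (F k) w v = dotv (gF k w) v)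
  (Hlip : forall (k : 'I_K) (w w' : 'rV[R]_D),
      enorm (gF k w - gF k w') <= L * enorm (w - w'))
  (* gFm is the gradient of F_m *)
  (HgFm : forall w : 'rV[R]_D,
      differentiable (Fglob F) w /\ forall v : 'rV[R]_D, 'd (Fglob F) w v = dotv (gFm w) v)
  (* channels and powers (fixed) *)
  (ch : channels R K Mo Kx)
  (Hch : forall t : nat,
      0 < pdl ch t /\ 0 < cul ch t /\ (forall l, 0 < pdlx ch t l) /\
      (forall k, 0 < pul ch t k /\ hdl ch t k != 0 /\ hul ch t k != 0) /\
      (forall k', 0 < pulx ch t k' /\ hulh ch t k' != 0))
  (* random symbols and noises *)
  (rv : randomness R Omega D K Mo Kx) (sigdl : 'I_K -> R) (sigul : R)
  (Hmeas : forall f, all_family rv f -> measurable_fun setT f)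
  (Hsdlx : forall t l dd, ('E_P[sdlx rv t l dd] = 0)%E /\
                          ('E_P[fun w => (sdlx rv t l dd w ^+ 2)%R] = 1)%E)
  (Hsul : forall t k dd, ('E_P[sul rv t k dd] = 0)%E /\
                         ('E_P[fun w => (sul rv t k dd w ^+ 2)%R] = 1)%E)
  (Hsulx : forall t k dd, ('E_P[sulx rv t k dd] = 0)%E /\
                          ('E_P[fun w => (sulx rv t k dd w ^+ 2)%R] = 1)%E)
  (Hunc_dl : forall t l l' dd, l != l' ->
      ('E_P[fun w => (sdlx rv t l dd w * sdlx rv t l' dd w)%R] = 0)%E)
  (Hunc_ul : forall t k k' dd, k != k' ->
      ('E_P[fun w => (sul rv t k dd w * sul rv t k' dd w)%R] = 0)%E)
  (Hunc_ulx : forall t k k' dd, k != k' ->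
      ('E_P[fun w => (sulx rv t k dd w * sulx rv t k' dd w)%R] = 0)%E)
  (Hunc_ul_ulx : forall t k k' dd,
      ('E_P[fun w => (sul rv t k dd w * sulx rv t k' dd w)%R] = 0)%E)
  (Hzdl : forall t k dd, cgauss P (zdl rv t k dd) (sigdl k))
  (Hzul : forall t dd, cgauss P (zul rv t dd) sigul)
  (* the uplink randomness of round t is independent of everything before it *)
  (Hindep : forall t : nat, (1 <= t)%N ->
      indep_sigma P (sigma_gen (ul_family rv t)) (sigma_gen (hist_family rv t)))
  (* constant learning rate 0 < eta < 1/L, initial model, horizon T *)
  (eta : R) (Heta : 0 < eta < L^-1) (w0 : 'rV[R]_D) (T : nat) (HT : (0 < T)%N) :
  let wt := wproc ch rv gF eta w0 in
  ((T%:R^-1)%:E * \sum_(t < T) 'E_P[fun w => (enorm (gFm (wt t w)) ^+ 2)%R] <=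
   ((2 / (eta * T%:R)) * (Fglob F w0 - Fglob F wstar))%:E +
   (T%:R^-1)%:E * \sum_(t < T) \sum_(dd < D)
      ((L ^+ 2 / K%:R)%:E *
         \sum_(k < K) 'E_P[fun w => (edlRe ch rv gF eta w0 t.+1 k dd w ^+ 2)%R] +
       (L * eta / (K%:R ^+ 2))%:E *
         'E_P[fun w => (eulRe ch rv gF eta w0 t.+1 dd w ^+ 2)%R]))%E.
Proof.
lazy zeta; set wt := wproc ch rv gF eta w0; have /andP[eta0 _] := Heta.
have K0 : 0 < K%:R :> R by rewrite ltr0n.
have T0 : 0 < T%:R :> R by rewrite ltr0n.
have a0 : 0 < L ^+ 2 / K%:R by rewrite divr_gt0// exprn_gt0.
have b0 : 0 < L * eta / K%:R ^+ 2 by rewrite divr_gt0 ?mulr_gt0// exprn_gt0.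
set S := (X in (_ <= _ + _ * X)%E).
(* An infinite noise sum makes the right-hand side infinite. *)
have [->|Sfin] := eqVneq S +oo%E.
  by rewrite gt0_muley ?lte_fin ?invr_gt0// addey// leey.
have E2_ge0 (X : Omega -> R) : (0 <= 'E_P[fun w => (X w ^+ 2)%R])%E.
  by apply: expectation_ge0 => w; rewrite sqr_ge0.
have dl_ge0 t dd : (0 <= (L ^+ 2 / K%:R)%:E *
    \sum_(k < K) 'E_P[fun w => (edlRe ch rv gF eta w0 t.+1 k dd w ^+ 2)%R])%E.
  by apply: mule_ge0; [rewrite lee_fin ltW|exact: sume_ge0].
have ul_ge0 t dd : (0 <= (L * eta / K%:R ^+ 2)%:E *
    'E_P[fun w => (eulRe ch rv gF eta w0 t.+1 dd w ^+ 2)%R])%E.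
  by apply: mule_ge0; [rewrite lee_fin ltW|].
have hist_meas t f : hist_family rv t f -> measurable_fun setT f.
  exact: hist_measurable.
have mw t : coord_measurable (wt t).
  by apply: (measurable_wproc _ _ _ HL Hlip) => f; exact: hist_meas.
have mdl t f : dl_family rv t f -> measurable_fun setT f.
  by move=> h; apply: Hmeas; exists t; left.
have mul t f : ul_family rv t f -> measurable_fun setT f.
  by move=> h; apply: Hmeas; exists t; right.
have medl t k dd : measurable_fun setT (edlRe ch rv gF eta w0 t.+1 k dd).
  have := measurable_what ch k (mdl t.+1) (mw t) dd.
  move=> /measurable_funB/(_ (mw t dd)).
  rewrite (_ : _ \- _ = edlRe ch rv gF eta w0 t.+1 k dd)//.
  by apply/funext => w /=; rewrite !mxE addrAC subrr add0r.
have meul t dd : measurable_fun setT (eulRe ch rv gF eta w0 t.+1 dd).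
  by apply: (measurable_eulRe_of ch HL Hlip) (mw t) dd => f [/mdl|/mul].
have Slt : (S < +oo)%E by rewrite lt_neqAle Sfin leey.
pose term t dd := ((L ^+ 2 / K%:R)%:E *
    \sum_(k < K) 'E_P[fun w => (edlRe ch rv gF eta w0 t.+1 k dd w ^+ 2)%R] +
    (L * eta / K%:R ^+ 2)%:E *
    'E_P[fun w => (eulRe ch rv gF eta w0 t.+1 dd w ^+ 2)%R])%E.
have term_ge0 t dd : (0 <= term t dd)%E by exact: adde_ge0.
(* All terms are nonnegative, so finiteness of the total passes to each term, and then to each
   second moment of an error. *)
have term_lty t (tT : (t < T)%N) dd : (term t dd < +oo)%E.
  apply: (sume_lty (f := term t)) => //.
  apply: (sume_lty (f := fun t : 'I_T => (\sum_(dd < D) term t dd)%E) _ Slt (Ordinal tT)).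
  by move=> t'; exact: sume_ge0.
have sdl t : (t < T)%N -> forall k dd, sqint P (edlRe ch rv gF eta w0 t.+1 k dd).
  move=> tT k dd; apply: sqint_expectation => //.
  apply: (sume_lty (f := fun k => 'E_P[fun w => (edlRe ch rv gF eta w0 t.+1 k dd w ^+ 2)%R]%E)) => //.
  apply: (mule_lty a0); apply: le_lt_trans (term_lty _ tT dd).
  by rewrite leeDl.
have sul2 t : (t < T)%N -> forall dd, sqint P (eulRe ch rv gF eta w0 t.+1 dd).
  move=> tT dd; apply: sqint_expectation => //.
  apply: (mule_lty b0); apply: le_lt_trans (term_lty _ tT dd).
  by rewrite leeDr.
(* Zero expectation alone does not give integrability; the unit second moment does. *)
have sym_mean0 (X : Omega -> R) : measurable_fun setT X ->
    ('E_P[X] = 0)%E -> ('E_P[fun w => (X w ^+ 2)%R] = 1)%E -> mean0 P X.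
  move=> mX X0 X1; split => //; apply: sqint_integrable.
  by apply: sqint_expectation => //; rewrite X1 ltry.
have sul_mean0 t k dd : mean0 P (sul rv t k dd).
  have [? ?] := Hsul t k dd; apply: sym_mean0 => //.
  by apply: (mul t); left; exists k, dd.
have sulx_mean0 t k dd : mean0 P (sulx rv t k dd).
  have [? ?] := Hsulx t k dd; apply: sym_mean0 => //.
  by apply: (mul t); right; left; exists k, dd.
have zul_mean0 t dd : mean0 P (fun w => complex.Re (zul rv t dd w)).
  have mz : measurable_fun setT (fun w => complex.Re (zul rv t dd w)).
    by apply: (mul t); right; right; exists dd; left.
  have [iz z0] := expectation_cgauss_Re mz (Hzul t dd).
  by split => //; rewrite unlock.
have sg := sqint_glocal HL Hlip sdl sul2.
have sw := sqint_wproc HL Hlip sdl sul2.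
have gradE := gradient_Fglob HgF HgFm.
have sgFm t : (t < T)%N -> forall dd, sqint P (fun w => gFm (wt t w) 0 dd).
  move=> tT dd; under [X in sqint _ X]eq_fun do rewrite gradE mxE summxE.
  apply: sqintZ; apply: sqint_sum => k; apply: (sqint_gF HL Hlip) => i.
  exact/sw/ltnW.
(* The coefficient combines local gradients with the gradient at the current model, both determined
   by the history and square integrable. *)
have cross0 t (tT : (t < T)%N) dd : mean0 P (fun w =>
    cross_coef ch gF gFm L eta w0 rv t w dd * eulRe ch rv gF eta w0 t.+1 dd w).
  apply: (mean0_eul HL Hlip Hmeas sdl sul2 sul_mean0 sulx_mean0 zul_mean0 Hindep dd tT).
    apply: measurable_funM => //; apply: measurable_funB.
      apply: measurable_funM => //; apply: measurable_funM => //.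
      apply: measurable_sum => k; exact: (gen_measurable_glocal ch eta w0 HL Hlip).
    under eq_fun do rewrite gradE mxE summxE.
    apply: measurable_funM => //; apply: measurable_sum => k.
    apply: (measurable_gF HL Hlip) => i.
    exact: (gen_measurable_wproc ch eta w0 HL Hlip).
  apply: sqintZ; apply: sqintB; last exact: sgFm.
  apply: sqintZ; apply: sqintZ; apply: sqint_sum => k; exact: sg.
have igrad (t : 'I_T) : P.-integrable setT (EFin \o (fun w => enorm (gFm (wt t w)) ^+ 2)).
  under [X in P.-integrable _ X]eq_fun do rewrite /= enorm_sqr dotvv.
  by apply: integrable_sumR => dd; case: (sgFm t (ltn_ord t) dd).
have idl (t : 'I_T) dd : P.-integrable setT (EFin \o (fun w =>
    \sum_(k < K) edlRe ch rv gF eta w0 t.+1 k dd w ^+ 2)).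
  by apply: integrable_sumR => k; case: (sdl t (ltn_ord t) k dd).
have iul (t : 'I_T) dd : P.-integrable setT (EFin \o (fun w =>
    eulRe ch rv gF eta w0 t.+1 dd w ^+ 2)).
  by case: (sul2 t (ltn_ord t) dd).
have inoise (t : 'I_T) dd : P.-integrable setT (EFin \o (fun w =>
    noise ch gF L eta w0 rv t w dd)).
  by apply: integrableDR; apply: integrableZR.
have noiseE : ('E_P[fun w => (\sum_(t < T) \sum_(dd < D) noise ch gF L eta w0 rv t w dd)%R] = S)%E.
  rewrite expect_sum; last by move=> t; exact: integrable_sumR.
  apply: eq_bigr => t _; rewrite expect_sum//; apply: eq_bigr => dd _.
  rewrite expectD; [|exact: integrableZR..].
  rewrite !expectZ// expect_sum// => k.
  by case: (sdl t (ltn_ord t) k dd).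
have crossE : mean0 P (fun w => \sum_(t < T) \sum_(dd < D)
    cross_coef ch gF gFm L eta w0 rv t w dd * eulRe ch rv gF eta w0 t.+1 dd w).
  apply: mean0_sum => t; apply: mean0_sum => dd; exact: cross0.
have inoises : P.-integrable setT (EFin \o (fun w =>
    \sum_(t < T) \sum_(dd < D) noise ch gF L eta w0 rv t w dd)).
  by apply: integrable_sumR => t; exact: integrable_sumR.
set c := 2 / eta * (Fglob F w0 - Fglob F wstar).
(* The expectation of the cross term, equal to 0, is added on the right so that the trajectory
   inequality can be integrated as it stands. *)
have main : (\sum_(t < T) 'E_P[fun w => (enorm (gFm (wt t w)) ^+ 2)%R] <= c%:E + S)%E.
  rewrite -noiseE -expect_sum//.
  rewrite -[leRHS]adde0 -crossE.2 -(expectation_cst P c) -expectD//; last exact: integrable_cstR.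
  rewrite -expectD//; [|exact: integrableDR (integrable_cstR P c) _|exact: crossE.1].
  rewrite unlock; apply: le_integral => //.
  - exact: integrable_sumR.
  - by apply: integrableDR crossE.1; exact: integrableDR (integrable_cstR P c) _.
  - by move=> w _; rewrite lee_fin; exact: (sum_gradient_le ch w0 HK Hlow HL HgF Hlip HgFm Heta).
apply: (@le_trans _ _ ((T%:R^-1)%:E * (c%:E + S))%E).
  by rewrite lee_pmul2l// lte_fin invr_gt0.
rewrite muleDr//.
rewrite -EFinM leeD2r// lee_fin /c le_eqVlt; apply/orP; left; apply/eqP.
by field; rewrite !gt_eqF.
Qed.
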